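(* Assume $u\in \mathcal{D}^{1,p}(\mathbb{R}^n)$ is nonconstant. Then $$[u]_{C^{1-n/p}(\mathbb{R}^n)}=\frac{|u(x_0)-u(y_0)|}{|x_0-y_0|^{1-n/p}}$$ for some $x_0,y_0\in \mathbb{R}^n$ with $x_0\neq y_0$.
   Context: Throughout, $n\ge 1$ is an integer and $n<p<\infty$. $\mathcal{D}^{1,p}(\mathbb{R}^n)$ is the space of $u\in L^1_{\mathrm{loc}}(\mathbb{R}^n)$ whose weak first-order partial derivatives all belong to $L^p(\mathbb{R}^n)$. Every such $u$ has a Hölder continuous representative and is always identified with it. Put $[u]_{C^{1-n/p}(\mathbb{R}^n)}:=\sup_{x\ne y}\frac{|u(x)-u(y)|}{|x-y|^{1-n/p}}$, which is finite for $u\in\mathcal{D}^{1,p}(\mathbb{R}^n)$ by Morrey's inequality. *)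

(* Defs.v *)
From HB Require Import structures.
From mathcomp Require Import all_boot all_order all_algebra.
From mathcomp Require Import all_classical all_reals all_analysis.

Set Implicit Arguments.
Unset Strict Implicit.
Unset Printing Implicit Defensive.

Import Order.TTheory GRing.Theory Num.Theory.
Import numFieldNormedType.Exports.

Local Open Scope classical_set_scope.
Local Open Scope ring_scope.

(* The Borel sigma-algebra of R^n, presented as the one generated by the
   coordinate functions (as the library does for n.-tuple T). *)
Definition rV_display : measure_display.
Proof. exact. Qed.

Section measurable_rV.
Context {R : realType} {n : nat}.

Let coors (i : 'I_n) (x : 'rV[R]_n) : measurableTypeR R := x ord0 i.

Let rV_set0 : g_sigma_preimage coors set0.
Proof. exact: sigma_algebra0. Qed.

Let rV_setC A : g_sigma_preimage coors A -> g_sigma_preimage coors (~` A).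
Proof. exact: sigma_algebraC. Qed.

Let rV_bigcup (F : (set 'rV[R]_n)^nat) :
  (forall i, g_sigma_preimage coors (F i)) ->
  g_sigma_preimage coors (\bigcup_i (F i)).
Proof. exact: sigma_algebra_bigcup. Qed.

HB.instance Definition _ := @isMeasurable.Build rV_display
  'rV[R]_n (g_sigma_preimage coors) rV_set0 rV_setC rV_bigcup.

Lemma measurable_coord (i : 'I_n) :
  measurable_fun [set: 'rV[R]_n] (coors i).
Proof.
move=> _ Y mY; rewrite setTI; apply: sub_sigma_algebra => /=.
rewrite -bigcup_seq/=; exists i => /=; first by rewrite mem_index_enum.
by exists Y => //; rewrite setTI.
Qed.

Lemma measurable_fun_rV d (T : measurableType d) (f : T -> 'rV[R]_n) :
  (forall i, measurable_fun setT (fun x => coors i (f x))) ->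
  measurable_fun setT f.
Proof.
move=> mf.
suff h : g_sigma_preimage (fun i => coors i \o f) `<=` measurable.
  move=> _ A mA; apply: h; rewrite g_sigma_preimage_comp.
  by exists A.
apply: smallest_sub; first exact: sigma_algebra_measurable.
rewrite -bigcup_seq/=; apply: bigcup_sub => i _.
by move=> A [B mB <-]; exact: mf.
Qed.

End measurable_rV.

Section lebesgue_rV.
Context {R : realType}.

Definition rV_cons n (x : measurableTypeR R * 'rV[R]_n) : 'rV[R]_n.+1 :=
  row_mx (x.1 : R)%:M x.2.

Lemma rV_cons0 n (x : measurableTypeR R * 'rV[R]_n) :
  rV_cons x ord0 ord0 = x.1.
Proof.
rewrite (_ : ord0 = lshift n (ord0 : 'I_1)); last exact: val_inj.
by rewrite /rV_cons; rewrite (row_mxEl (x.1 : R)%:M) mxE eqxx.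
Qed.

Lemma rV_consS n (x : measurableTypeR R * 'rV[R]_n) (i : 'I_n) :
  rV_cons x ord0 (lift ord0 i) = x.2 ord0 i.
Proof.
rewrite (_ : lift ord0 i = rshift 1 i); last exact: val_inj.
by rewrite /rV_cons (row_mxEr (x.1 : R)%:M).
Qed.

Lemma measurable_rV_cons n : measurable_fun setT (@rV_cons n).
Proof.
apply: measurable_fun_rV => i; case: (unliftP ord0 i) => [j|] ->.
- under eq_fun do rewrite rV_consS.
  exact: (measurableT_comp (measurable_coord j) measurable_snd).
- under eq_fun do rewrite rV_cons0.
  exact: measurable_fst.
Qed.

Section step.
Context {n : nat} (m : {sigma_finite_measure set 'rV[R]_n -> \bar R}).

Definition lebesgue_rV_step : set 'rV[R]_n.+1 -> \bar R :=
  pushforward (lebesgue_measure \x m)%E (@rV_cons n).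

Local Notation mu := (lebesgue_measure \x m)%E.
Let mcons := @measurable_rV_cons n.

Let step0 : lebesgue_rV_step set0 = 0%E.
Proof. by rewrite /lebesgue_rV_step /pushforward preimage_set0 measure0. Qed.

Let step_ge0 A : (0 <= lebesgue_rV_step A)%E.
Proof. exact: measure_ge0. Qed.

Let step_sigma_additive : semi_sigma_additive lebesgue_rV_step.
Proof.
exact: (@measure_semi_sigma_additive _ _ _
  (measure_function_pushforward__canonical__measure_function_Measure mu mcons)).
Qed.

HB.instance Definition _ := isMeasure.Build _ _ _ lebesgue_rV_step
  step0 step_ge0 step_sigma_additive.

Let product_sigma_finite : sigma_finite setT mu.
Proof.
have /sigma_finiteP[F [TF ndF Foo]] :=
  sigma_finiteT (@lebesgue_measure R : {sigma_finite_measure set _ -> \bar R}).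
have /sigma_finiteP[G [TG ndG Goo]] := sigma_finiteT m.
exists (fun k => F k `*` G k).
  rewrite -setXTT TF TG predeqE => -[x y]; split.
    move=> [/= [i _ Fx] [j _ Gy]]; exists (maxn i j) => //; split.
    - by move: x Fx; exact/subsetPset/ndF/leq_maxl.
    - by move: y Gy; exact/subsetPset/ndG/leq_maxr.
  by move=> [k _ []/= ? ?]; split; exists k.
move=> k; have [? ?] := Foo k; have [? ?] := Goo k.
split; first exact: measurableX.
by rewrite product_measure1E// lte_mul_pinfty// ge0_fin_numE.
Qed.

Let step_sigma_finite : sigma_finite setT lebesgue_rV_step.
Proof.
have [F UF Fi] := product_sigma_finite.
pose g (y : 'rV[R]_n.+1) : measurableTypeR R * 'rV[R]_n :=
  (y ord0 ord0, \row_i y ord0 (lift ord0 i)).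
have gK x : g (rV_cons x) = x.
  case: x => a v; congr pair; first exact: (rV_cons0 (a, v)).
  by apply/rowP => i; rewrite mxE (rV_consS (a, v)).
have mg : measurable_fun setT g.
  apply/measurable_fun_pairP; split; first exact: measurable_coord.
  apply: measurable_fun_rV => i.
  rewrite (_ : (fun _ => _) =
    (fun y : 'rV[R]_n.+1 => y ord0 (lift ord0 i) : measurableTypeR R)).
    exact: measurable_coord.
  by apply/funext => y; rewrite /= mxE.
exists (fun k => g @^-1` F k).
  by rewrite -preimage_bigcup -UF preimage_setT.
move=> k; have [mF Foo] := Fi k; split.
  by rewrite -[X in measurable X]setTI; exact: mg.
rewrite /lebesgue_rV_step /pushforward -comp_preimage.
by rewrite (_ : g \o _ = id)//; apply/funext => x /=; exact: gK.
Qed.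

HB.instance Definition _ := @Measure_isSigmaFinite.Build _ _ _
  lebesgue_rV_step step_sigma_finite.

End step.

(* R^(n+1) = R x R^n carries the product measure, R^0 the unit mass; see
   lebesgue_rV_box below for the volume of boxes. *)
Fixpoint lebesgue_rV n : {sigma_finite_measure set 'rV[R]_n -> \bar R} :=
  match n with
  | 0 => dirac (0 : 'rV[R]_0)
  | k.+1 => lebesgue_rV_step (lebesgue_rV k)
  end.

Lemma lebesgue_rV_box n (a b : 'rV[R]_n) :
  (forall i, a ord0 i <= b ord0 i) ->
  lebesgue_rV n [set x : 'rV[R]_n | forall i, a ord0 i <= x ord0 i <= b ord0 i] =
  (\prod_i (b ord0 i - a ord0 i))%:E.
Proof.
elim: n a b => [|n IH] a b ab.
  rewrite big_ord0 /= diracE mem_set//= => -[].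
  by [].
pose t (v : 'rV[R]_n.+1) : 'rV[R]_n := \row_i v ord0 (lift ord0 i).
have -> : lebesgue_rV n.+1 [set x | forall i, a ord0 i <= x ord0 i <= b ord0 i] =
   (lebesgue_measure \x lebesgue_rV n)%E ((`[a ord0 ord0, b ord0 ord0]%classic : set (measurableTypeR R)) `*`
     [set x : 'rV[R]_n | forall i, t a ord0 i <= x ord0 i <= t b ord0 i]).
  rewrite /= /lebesgue_rV_step /pushforward; congr (_ _).
  apply/seteqP; split => [x /= h|x /= [h1 h2] i].
    split; first by have := h ord0; rewrite rV_cons0 in_itv.
    by move=> i; have := h (lift ord0 i); rewrite rV_consS !mxE.
  case: (unliftP ord0 i) => [j|] ->.
    by have := h2 j; rewrite rV_consS !mxE.
  by rewrite rV_cons0; move: h1; rewrite in_itv.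
rewrite product_measure1E//.
- rewrite IH; last by move=> i; rewrite !mxE.
  rewrite big_ord_recl EFinM; congr (_ * _)%E.
    rewrite [LHS](lebesgue_measure_itv `[a ord0 ord0, b ord0 ord0]) /= lte_fin.
    case: ltP => // ba; have /eqP -> : a ord0 ord0 == b ord0 ord0.
      by rewrite eq_le ab ba.
    by rewrite subrr.
  by congr EFin; apply: eq_bigr => i _; rewrite !mxE.
- rewrite (_ : mkset _ = \bigcap_(i in [set: 'I_n])
     ((fun x : 'rV[R]_n => x ord0 i : measurableTypeR R) @^-1`
       `[t a ord0 i, t b ord0 i]%classic)).
    apply: fin_bigcap_measurable => // i _.
    by rewrite -[X in measurable X]setTI; exact: measurable_coord.
  by apply/seteqP; split => x /= h i; have := h i; rewrite /= in_itv; auto.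
Qed.

End lebesgue_rV.

Section sobolev.
Context {R : realType} {n : nat}.
Implicit Types (u g phi : 'rV[R]_n -> R) (p a : R).

Local Notation mu := (@lebesgue_rV R n).

Definition partial (i : 'I_n) u : 'rV[R]_n -> R :=
  fun x => 'D_(delta_mx ord0 i) u x.

(* C^k: all iterated partial derivatives of order at most k exist and are
   continuous. *)
Fixpoint Ck (k : nat) u : Prop :=
  continuous u /\
  match k with
  | 0 => True
  | k'.+1 => forall i : 'I_n,
      (forall x, derivable u x (delta_mx ord0 i)) /\ Ck k' (partial i u)
  end.

Definition test_function phi : Prop :=
  (forall k, Ck k phi) /\ compact (closure [set x | phi x != 0]).

(* Measurability is Borel: every Lebesgue measurable function agrees almost
   everywhere with a Borel one, so the a.e. classes are the usual ones. *)
Definition L1loc u : Prop :=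
  measurable_fun setT u /\
  forall K, compact K -> (\int[mu]_(x in K) `|u x|%:E < +oo)%E.

Definition weak_partial (i : 'I_n) u g : Prop :=
  L1loc g /\
  forall phi, test_function phi ->
    (\int[mu]_x (u x * partial i phi x)%:E =
     - \int[mu]_x (g x * phi x)%:E)%E.

Definition D1p p u : Prop :=
  L1loc u /\
  forall i : 'I_n, exists2 g, weak_partial i u g & g \in Lfun mu p%:E.

(* The Euclidean norm; the library norm `|x| on 'rV[R]_n is the sup norm. *)
Definition enorm (x : 'rV[R]_n) : R := Num.sqrt (\sum_i x ord0 i ^+ 2).

Definition holder_quotient a u (x y : 'rV[R]_n) : R :=
  `|u x - u y| / (enorm (x - y)) `^ a.

(* Valued in \bar R, so that an equality with a real number includes the
   finiteness of the supremum. *)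
Definition holder_seminorm a u : \bar R :=
  ereal_sup [set (holder_quotient a u xy.1 xy.2)%:E |
             xy in [set xy : 'rV[R]_n * 'rV[R]_n | xy.1 != xy.2]].

End sobolev.

(* Main.v *)
(* Compare the averages of u against two product bumps carried by nested cubes
   Q' in Q of sides r/2 and r. Their difference is the divergence of an explicit
   test field supported in Q and of size O(r^(1-n)), so the definition of weak
   derivatives and Hoelder's inequality bound the difference of the averages by
   C r^(1-n/p) (int_Q sum_i |g_i|^p)^(1/p). Summing along cubes shrinking to a
   point gives Morrey's inequality with the energy of the cube only. As that
   energy is uniformly small on small cubes and on cubes far from the origin,
   and u(x) = o(|x|^(1-n/p)) at infinity, the Hoelder quotient is small off a
   compact set of pairs x <> y; on this set it is continuous, so it attains its
   maximum. *)
Require Import Defs.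
From mathcomp Require Import all_boot all_order all_algebra.
From mathcomp Require Import all_classical all_reals all_analysis measurable_realfun.
From mathcomp Require Import ring lra.

Set Implicit Arguments.
Unset Strict Implicit.
Unset Printing Implicit Defensive.

Import Order.TTheory GRing.Theory Num.Theory.
Import numFieldNormedType.Exports.

Local Open Scope classical_set_scope.
Local Open Scope ring_scope.

(** A maximising sequence of pairs can lose compactness in two ways: its points merge, or the pair
    escapes to infinity. Morrey's inequality with the full energy only bounds the quotient there.
    Keeping the energy of the cube makes the quotient smaller than any prescribed number, in
    particular smaller than half the quotient of a fixed pair where [u] takes two values. Distant
    points whose common cube meets the region carrying the energy escape this argument. For them the
    difference is not estimated along the cube at all: each of [u x] and [u y] is separately small
    compared with the distance. Since [u] has only weak derivatives, it is probed through integrals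
    against test functions. Taking these as products of one-variable functions reduces smoothness,
    support, mass and the solution of the divergence equation to one variable. Estimates are made in
    the sup norm, whose balls are cubes. The Euclidean norm is larger, so replacing one by the other
    in the denominator only lowers the quotient, and no comparison constant appears. *)

Section smooth_real.
Context {R : realType}.
Implicit Types (f g h : R -> R) (P : {poly R}).

(** One-variable counterpart of [Ck]. The derivative is an existential witness, so closure under
    products and composition amounts to exhibiting it. *)
Fixpoint Ck1 k h : Prop :=
  continuous h /\
  match k with
  | 0 => True
  | k'.+1 => exists2 h' : R -> R, (forall x : R, is_derive x 1 h (h' x)) & Ck1 k' h'
  end.

Definition smooth h := forall k, Ck1 k h.

Lemma Ck1_continuous k h : Ck1 k h -> continuous h.
Proof. by case: k => [|k] []. Qed.

Lemma is_derive_continuous h h' : (forall x : R, is_derive x 1 h (h' x)) ->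
  continuous h.
Proof.
by move=> dh x; apply/differentiable_continuous/derivable1_diffP; case: (dh x).
Qed.

Lemma Ck1S k h h' : (forall x : R, is_derive x 1 h (h' x)) -> Ck1 k h' ->
  Ck1 k.+1 h.
Proof. by move=> dh ch'; split; [exact: is_derive_continuous dh|exists h']. Qed.

Lemma Ck1W k h : Ck1 k.+1 h -> Ck1 k h.
Proof.
elim: k h => [|k IH] h; first by case.
by move=> [ch [h' dh /IH ch']]; apply: Ck1S ch'.
Qed.

Lemma Ck1D k f g : Ck1 k f -> Ck1 k g -> Ck1 k (f \+ g).
Proof.
elim: k f g => [|k IH] f g.
  by move=> [cf _] [cg _]; split=> // x; apply: cvgD; [exact: cf|exact: cg].
move=> [_ [f' df cf]] [_ [g' dg cg]].
by apply: Ck1S (IH _ _ cf cg) => x; apply: is_deriveD.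
Qed.

Lemma Ck1M k f g : Ck1 k f -> Ck1 k g -> Ck1 k (f \* g).
Proof.
elim: k f g => [|k IH] f g.
  by move=> [cf _] [cg _]; split=> // x; apply: cvgM; [exact: cf|exact: cg].
move=> /[dup] /Ck1W cf [_ [f' df cf']] /[dup] /Ck1W cg [_ [g' dg cg']].
by apply: Ck1S (Ck1D (IH _ _ cf cg') (IH _ _ cg cf')) => x.
Qed.

Lemma Ck1_cst k (c : R) : Ck1 k (fun=> c).
Proof.
elim: k c => [|k IH] c; first by split=> //; exact: cst_continuous.
by apply: Ck1S (IH 0) => x; apply: is_derive_cst.
Qed.

Lemma is_derive_affine (a b x : R) : is_derive x 1 (fun t => a * t + b) a.
Proof.
rewrite (_ : (fun t => _) = a \*: (@id R) + cst b)//.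
by apply: is_derive_eq; rewrite addr0 [LHS]mulr1.
Qed.

Lemma smooth_cst (c : R) : smooth (fun=> c).
Proof. by move=> k; exact: Ck1_cst. Qed.

Lemma smooth_affine (a b : R) : smooth (fun t => a * t + b).
Proof.
move=> [|k]; last by apply: Ck1S (Ck1_cst k a) => x; exact: is_derive_affine.
by split=> //; apply: (@is_derive_continuous _ (fun=> a)) => x; exact: is_derive_affine.
Qed.

Lemma smoothD f g : smooth f -> smooth g -> smooth (f \+ g).
Proof. by move=> sf sg k; exact: Ck1D. Qed.

Lemma smoothM f g : smooth f -> smooth g -> smooth (f \* g).
Proof. by move=> sf sg k; exact: Ck1M. Qed.

Lemma Ck1_comp k f g : Ck1 k f -> Ck1 k g -> Ck1 k (f \o g).
Proof.
elim: k f g => [|k IH] f g.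
  move=> [cf _] [cg _]; split=> // x.
  by apply: continuous_comp; [exact: cg|exact: cf].
move=> [_ [f' df cf']] /[dup] /Ck1W cg [_ [g' dg cg']].
by apply: Ck1S (Ck1M (IH _ _ cf' cg) cg') => x; exact: is_derive1_comp.
Qed.

Lemma smooth_comp f g : smooth f -> smooth g -> smooth (f \o g).
Proof. by move=> sf sg k; exact: Ck1_comp. Qed.

Lemma smooth_derive h h' : smooth h -> (forall x : R, is_derive x 1 h (h' x)) ->
  smooth h'.
Proof.
move=> sh dh k; have [_ [h'' dh'' ch'']] := sh k.+1.
rewrite (_ : h' = h'')//; apply/funext => x.
by have [_ <-] := dh x; have [_ <-] := dh'' x.
Qed.

(** * The flat function exp(-1/t) and a smooth step *)

Definition expinv P (t : R) : R :=
  if 0 < t then P.[t^-1] * expR (- t^-1) else 0.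

(** A single term of the exponential series gives s^i <= i! exp(s), hence the factorial weights on
    the coefficients. *)
Lemma poly_expRN_bound P : exists2 C, 0 <= C &
  forall s, 0 <= s -> `|P.[s] * expR (- s)| <= C.
Proof.
exists (\sum_(i < size P) `|P`_i| * i`!%:R).
  by apply: sumr_ge0 => i _; rewrite mulr_ge0.
move=> s s0; rewrite normrM [X in _ * X]ger0_norm ?expR_ge0// expRN.
rewrite ler_pdivrMr ?expR_gt0// horner_coef mulr_suml.
apply: le_trans (ler_norm_sum _ _ _) _; apply: ler_sum => i _.
rewrite normrM -mulrA; apply: ler_wpM2l => //.
rewrite ger0_norm ?exprn_ge0//; case: (nat_of_ord i) => [|m].
  by rewrite expr0 fact0 mul1r (le_trans _ (expR_ge1Dx s))// lerDl.
rewrite mulrC -ler_pdivrMr ?ltr0n ?fact_gt0//.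
by apply: le_trans (expR_ge1Dxn m s0); rewrite lerDr.
Qed.

Lemma expinv_cvg0 P : {for 0, continuous (expinv P)}.
Proof.
(* The extra factor ['X] pays for a factor 1/t: at s = 1/t the bound reads
   [|expinv P t| <= C * |t|]. *)
have [C C0 HC] := poly_expRN_bound ('X * P).
have bnd z : `|expinv P z| <= C * `|z|.
  rewrite /expinv; case: ifPn => [z0|_]; last by rewrite normr0 mulr_ge0.
  have := HC z^-1; rewrite invr_ge0 => /(_ (ltW z0)).
  rewrite hornerM hornerX -mulrA normrM normfV mulrC ler_pdivrMr//.
  by rewrite normr_gt0 gt_eqF.
suff: expinv P z @[z --> (0 : R)] --> (0 : R).
  by rewrite -[X in _ --> X](_ : expinv P 0 = 0)// /expinv ltxx.
apply/cvgr0Pnorm_le => e e0.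
have C1 : 0 < C + 1 by rewrite ltr_wpDl.
have Hz : \forall z \near (0 : R), `|z| <= e / (C + 1).
  by apply: nbhs0_le; rewrite divr_gt0.
near=> z; apply: (le_trans (bnd z)).
apply: (@le_trans _ _ ((C + 1) * `|z|)); first by rewrite ler_wpM2r// lerDl.
rewrite mulrC -ler_pdivlMr//; near: z.
exact: Hz.
Unshelve. all: by end_near. Qed.

(** Polynomials in 1/t are carried along because they make the family stable under differentiation;
    smoothness is then one induction over all [P]. *)
Lemma expinv_is_derive P (x : R) :
  is_derive x 1 (expinv P) (expinv ('X ^+ 2 * (P - P^`())) x).
Proof.
have [x0|x0|->] := ltgtP x 0.
- rewrite [X in is_derive _ _ _ X](_ : _ = 0); last by rewrite /expinv ltNge ltW.
  apply: near_eq_is_derive (is_derive_cst 0 x 1).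
  near=> z; rewrite /expinv ifF//; apply/negbTE; rewrite -leNgt ltW//.
  by near: z; exact: lt_nbhsl.
- have dV : is_derive x 1 (fun t : R => t^-1) (- x ^- 2).
    by apply: is_derive_eq (is_deriveV _ (is_derive_id x 1)) _;
      rewrite ?gt_eqF// [LHS]mulr1.
  have dNV : is_derive x 1 (fun t : R => - t^-1) (x ^- 2).
    by apply: is_derive_eq (is_deriveN dV) _; rewrite opprK.
  have dP : is_derive x 1 (fun t : R => P.[t^-1]) (P^`().[x^-1] * - x ^- 2).
    exact: (is_derive1_comp (f := horner P) (g := fun t : R => t^-1)).
  have dE : is_derive x 1 (fun t : R => expR (- t^-1)) (expR (- x^-1) * x ^- 2).
    exact: (is_derive1_comp (f := expR) (g := fun t : R => - t^-1)).
  apply: near_eq_is_derive (is_derive_eq (is_deriveM dP dE) _).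
    near=> z; rewrite /expinv ifT//; near: z; exact: lt_nbhsr.
  rewrite /expinv x0 !hornerE /= -![_ *: _]/(_ * _) exprVn; ring.
- rewrite [X in is_derive _ _ _ X](_ : _ = 0); last by rewrite /expinv ltxx.
  apply/is_derive1_caratheodory.
  (* The difference quotient at 0 multiplies by 1/t, so it is again a member of the family,
     continuous at 0. *)
  exists (expinv ('X * P)); split; last by rewrite /expinv ltxx.
    move=> z; rewrite /expinv ltxx !subr0; case: ifPn => z0; last by rewrite mul0r.
    by rewrite hornerM hornerX; field; rewrite gt_eqF.
  exact: expinv_cvg0.
Unshelve. all: by end_near. Qed.

Lemma expinv_smooth P : smooth (expinv P).
Proof.
move=> k; elim: k P => [|k IH] P; last exact: Ck1S (expinv_is_derive P) (IH _).
by split=> //; exact: is_derive_continuous (expinv_is_derive P).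
Qed.

(** [beta] is a bump and [S] its antiderivative. The rise of [S] from 0 to 1 is the unit mass of
    [beta], and having [S] at hand makes differences of bumps explicit derivatives. *)
Record step_profile (S beta : R -> R) (B : R) : Prop := StepProfile {
  step_smooth : smooth S;
  step_deriv_smooth : smooth beta;
  step_deriv : forall x : R, is_derive x 1 S (beta x);
  step_left : forall t, t <= 0 -> S t = 0;
  step_right : forall t, 1 <= t -> S t = 1;
  step_range : forall t, 0 <= S t <= 1;
  step_deriv_range : forall t, 0 <= beta t <= B;
  step_deriv_supp : forall t, ~~ (0 <= t <= 1) -> beta t = 0
}.

(* [S t = e f (1 - e f (1 - t))] with [f t = exp (- 1 / t)] for [0 < t]: the
   argument of the outer [f] is [<= 0] when [t <= 0] and [1] when [1 <= t]. *)
Lemma step_profile_exists : exists S beta B, step_profile S beta B.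
Proof.
pose f := expinv 1; pose e := expR (1 : R).
have f0 t : t <= 0 -> f t = 0 by move=> t0; rewrite /f /expinv ltNge t0.
have f1 : f 1 = e^-1 by rewrite /f /expinv ltr01 hornerE mul1r invr1 expRN.
have fge0 t : 0 <= f t.
  by rewrite /f /expinv; case: ifP => // _; rewrite hornerE ?mul1r expR_ge0.
have e0 : 0 < e by exact: expR_gt0.
pose f' := expinv ('X ^+ 2 * (1 - 1^`())).
have df (x : R) : is_derive x 1 f (f' x) by exact: expinv_is_derive.
have f'ge0 t : 0 <= f' t.
  rewrite /f' /expinv; case: ifP => // t0.
  by rewrite derivC subr0 mulr1 mulr_ge0 ?expR_ge0// !hornerE exprn_ge0// invr_ge0 ltW.
have f'0 t : t <= 0 -> f' t = 0 by move=> t0; rewrite /f' /expinv ltNge t0.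
have fle s t : s <= t -> f s <= f t.
  move=> st; rewrite /f /expinv; case: ifPn => s0; case: ifPn => t0 //.
  - rewrite !hornerE ?mul1r ler_expR lerN2 lef_pV2//.
  - by rewrite (lt_le_trans s0) in t0.
  - by rewrite hornerE ?mul1r expR_ge0.
pose g t := - e * f (-1 * t + 1) + 1.
have gle t : g t <= 1 by rewrite /g; have := mulr_ge0 (ltW e0) (fge0 (-1 * t + 1)); lra.
have g0 t : t <= 0 -> g t <= 0.
  move=> t0; have : f 1 <= f (-1 * t + 1) by apply: fle; lra.
  by rewrite f1 -(ler_pM2l e0) mulfV ?gt_eqF// /g; lra.
have g1 t : 1 <= t -> g t = 1.
  by move=> t1; rewrite /g f0 ?mulr0 ?add0r//; lra.
pose S t := e * f (g t) + 0.
pose beta t := e * (f' (g t) * (- e * (f' (-1 * t + 1) * -1))).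
have sf : smooth f by exact: expinv_smooth.
have sg : smooth g.
  exact: (smooth_comp (smooth_affine (- e) 1) (smooth_comp sf (smooth_affine _ _))).
have sS : smooth S.
  exact: (smooth_comp (smooth_affine e 0) (smooth_comp sf sg)).
have dS (x : R) : is_derive x 1 S (beta x).
  have dgi := is_derive1_comp (df _) (is_derive_affine (-1) 1 x).
  have dg := is_derive1_comp (is_derive_affine (- e) 1 _) dgi.
  exact: (is_derive1_comp (is_derive_affine e 0 _) (is_derive1_comp (df (g x)) dg)).
have sbeta : smooth beta by exact: smooth_derive dS.
have beta0 t : ~~ (0 <= t <= 1) -> beta t = 0.
  rewrite negb_and -!ltNge => /orP[t0|t1].
    by rewrite /beta f'0 ?mul0r ?mulr0// g0// ltW.
  by rewrite /beta (f'0 (-1 * t + 1)) ?mul0r ?mulr0 ?mul0r ?mulr0//; lra.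
have betage0 t : 0 <= beta t.
  rewrite /beta mulr_ge0 ?(ltW e0)// mulr_ge0//.
  by rewrite mulrN1 mulrNN mulr_ge0 ?(ltW e0).
have [|m _ maxm] := @EVT_max R beta 0 1 ler01.
  by apply: continuous_subspaceT; exact: Ck1_continuous (sbeta 0).
exists S, beta, (beta m); split=> //.
- by move=> t t0; rewrite /S addr0 f0 ?mulr0// g0.
- by move=> t t1; rewrite /S addr0 g1// f1 mulfV// gt_eqF.
- move=> t; rewrite /S addr0 mulr_ge0 ?(ltW e0)//=.
  by rewrite -[leRHS](mulfV (lt0r_neq0 e0)) ler_pM2l// -f1 fle.
- move=> t; rewrite betage0/=.
  have [t01|/beta0 ->//] := boolP (0 <= t <= 1).
  by apply: maxm; rewrite in_itv.
Qed.

End smooth_real.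

(** * Products of one-variable functions, and cubes *)

Section product_functions.
Context {R : realType} {n : nat}.
Implicit Types (h a b : 'I_n -> R -> R) (x c : 'rV[R]_n) (r : R).

Definition prodfun h x : R := \prod_(i < n) h i (x ord0 i).

Definition cube c r : set 'rV[R]_n :=
  [set x | forall i, c ord0 i <= x ord0 i <= c ord0 i + r].

Lemma prodfun_continuous h : (forall i, continuous (h i)) ->
  continuous (prodfun h).
Proof.
move=> ch; apply: continuous_big; first exact: mul_continuous.
move=> i _ x; apply: (continuous_comp (f := fun y : 'rV[R]_n => y ord0 i)).
  exact: coord_continuous.
exact: ch.
Qed.

(** Along the [i]-th axis the other factors are constant, so the difference quotient is the
    one-variable quotient times a constant. *)
Lemma is_derive_prodfun h i x (d : R) : is_derive (x ord0 i) 1 (h i) d ->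
  is_derive x (delta_mx ord0 i) (prodfun h)
    (d * \prod_(j < n | j != i) h j (x ord0 j)).
Proof.
move=> [dh hd]; set c := \prod_(j < n | _) _.
have E : (fun t : R => t^-1 *: ((prodfun h \o shift x) (t *: delta_mx ord0 i) -
      prodfun h x)) =
    (fun t : R => t^-1 *: ((h i \o shift (x ord0 i)) (t *: 1) - h i (x ord0 i)) * c).
  apply/funext => t; rewrite /prodfun /= (bigD1 i)//= [X in _ - X](bigD1 i)//=.
  rewrite !mxE !eqxx /= -/c.
  rewrite (eq_bigr (fun j => h j (x ord0 j))); last first.
    by move=> j /negbTE ji; rewrite !mxE eqxx ji /= mulr0 add0r.
  by rewrite -mulrBl scalerAl.
have L : t^-1 *: ((prodfun h \o shift x) (t *: delta_mx ord0 i) - prodfun h x)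
    @[t --> 0^'] --> d * c.
  rewrite E; apply: cvgMl; rewrite -hd; exact: dh.
by apply: DeriveDef; [apply: cvgP L|apply: cvg_lim L].
Qed.

Lemma Ck_prodfun k h : (forall i, Ck1 k (h i)) -> Ck k (prodfun h).
Proof.
elim: k h => [|k IH] h ch.
  by split=> //; apply: prodfun_continuous => i; exact: Ck1_continuous (ch i).
split; first by apply: prodfun_continuous => i; exact: Ck1_continuous (ch i).
move=> i; have [_ [h' dh' ch']] := ch i.
pose H j := if j == i then h' else h j.
have dp x : is_derive x (delta_mx ord0 i) (prodfun h) (prodfun H x).
  apply: is_derive_eq (is_derive_prodfun (dh' (x ord0 i))) _.
  rewrite /prodfun [RHS](bigD1 i)//= {1}/H eqxx; congr (_ * _).
  by apply: eq_bigr => j /negbTE ji; rewrite /H ji.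
split; first by move=> x; have [] := dp x.
have -> : partial i (prodfun h) = prodfun H.
  by apply/funext => x; have [_] := dp x.
apply: IH => j; rewrite /H; case: ifP => // _; exact: Ck1W.
Qed.

Lemma cube_compact c r : compact (cube c r).
Proof.
have := @rV_compact R n (fun i => `[c ord0 i, c ord0 i + r]%classic)
  (fun i => @segment_compact _ _ _).
by congr compact; apply/seteqP; split => x /= xc i; have := xc i; rewrite in_itv.
Qed.

Lemma cube_measurable c r : measurable (cube c r).
Proof.
rewrite (_ : cube c r = \bigcap_(i in [set: 'I_n])
     ((fun x : 'rV[R]_n => x ord0 i : measurableTypeR R) @^-1`
       `[c ord0 i, c ord0 i + r]%classic)).
  apply: fin_bigcap_measurable => // i _.
  by rewrite -[X in measurable X]setTI; exact: measurable_coord.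
by apply/seteqP; split => x /= xc i; have := xc i; rewrite /= in_itv; auto.
Qed.

Lemma cube_volume c r : 0 <= r -> lebesgue_rV n (cube c r) = (r ^+ n)%:E.
Proof.
move=> r0; have := @lebesgue_rV_box R n c (\row_i (c ord0 i + r)).
rewrite (_ : mkset _ = cube c r); last first.
  by apply/seteqP; split => x /= xc i; have := xc i; rewrite mxE.
move=> ->; last by move=> i; rewrite mxE lerDl.
congr EFin; under eq_bigr do rewrite mxE addrC addKr.
by rewrite prodr_const card_ord.
Qed.

Lemma prodfun_supp h c r :
  (forall i t, ~~ (c ord0 i <= t <= c ord0 i + r) -> h i t = 0) ->
  forall x, ~ cube c r x -> prodfun h x = 0.
Proof.
move=> h0 x; rewrite /cube /= -existsNE => -[i /negP xi].
by rewrite /prodfun (bigD1 i)//= h0// mul0r.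
Qed.

Lemma test_function_prodfun h c r : (forall i, smooth (h i)) ->
  (forall x, ~ cube c r x -> prodfun h x = 0) -> test_function (prodfun h).
Proof.
move=> sh h0; split; first by move=> k; apply: Ck_prodfun => i; exact: sh.
apply: (subclosed_compact _ (@cube_compact c r)); first exact: closed_closure.
have clc : closed (cube c r).
  by apply: (compact_closed _ (@cube_compact c r)); exact: norm_hausdorff.
rewrite [X in _ `<=` X](closure_id _).1//; apply: closureS => x /=.
by apply: contraPP => /h0 ->; rewrite eqxx.
Qed.

Lemma measurable_prodfun h : (forall i, measurable_fun setT (h i)) ->
  measurable_fun setT (prodfun h).
Proof.
move=> mh; apply: measurable_prod => i _.
exact: (measurableT_comp (mh i) (measurable_coord i)).
Qed.

End product_functions.

(** Induction along the recursive construction of the measure: the first factor splits off by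
    Tonelli, which applies because the factors are nonnegative. *)
Lemma integral_prodfun {R : realType} n (h : 'I_n -> R -> R) :
  (forall i, measurable_fun setT (h i)) -> (forall i t, 0 <= h i t) ->
  (forall i, \int[@lebesgue_measure R]_t (h i t)%:E = 1)%E ->
  (\int[lebesgue_rV n]_x (prodfun h x)%:E = 1)%E.
Proof.
elim: n h => [|n IH] h mh h0 h1.
  under eq_integral do rewrite /prodfun big_ord0.
  by rewrite integral_cst//= mul1e diracT.
pose h' i := h (lift ord0 i).
have mp := measurable_prodfun mh.
transitivity (\int[(lebesgue_measure \x lebesgue_rV n)%E]_z
    ((fun x => (prodfun h x)%:E) \o @rV_cons R n) z)%E.
  apply: (@ge0_integral_pushforward _ _ _ _ R _ (@measurable_rV_cons R n)
    (lebesgue_measure \x lebesgue_rV n)%E setT) => //.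
    exact/measurable_EFinP.
  by move=> ? _; rewrite lee_fin; apply: prodr_ge0.
have E z : prodfun h (rV_cons z) = h ord0 z.1 * prodfun h' z.2.
  rewrite /prodfun big_ord_recl rV_cons0; congr (_ * _).
  by apply: eq_bigr => i _; rewrite rV_consS.
rewrite fubini_tonelli1/=; last 2 first.
- apply/measurable_EFinP; exact: (measurableT_comp mp (@measurable_rV_cons R n)).
- by move=> z; rewrite lee_fin; apply: prodr_ge0.
transitivity (\int[lebesgue_measure]_t (h ord0 t)%:E)%E; last exact: h1.
apply: eq_integral => t _; rewrite /fubini_F /=.
under eq_integral do rewrite E /= EFinM.
have mh' : measurable_fun setT (prodfun h').
  by apply: measurable_prodfun => i; exact: mh.
have p0 x : [set: 'rV[R]_n] x -> (0 <= (prodfun h' x)%:E)%E.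
  by rewrite lee_fin => _; apply: prodr_ge0 => i _; exact: h0.
rewrite (ge0_integralZl_EFin (lebesgue_rV n : {measure set _ -> \bar R})
  measurableT p0 _ (h0 ord0 t)).
- have IHh' : (\int[lebesgue_rV n]_x (prodfun h' x)%:E = 1)%E.
    by apply: IH => i; [exact: mh|move=> s; exact: h0|exact: h1].
  by rewrite IHh' mule1.
- exact/measurable_EFinP.
Qed.

(** * Steps and unit-mass bumps on an arbitrary interval *)

Section scaled_step.
Context {R : realType}.
Context (S beta : R -> R) (B : R) (sp : step_profile S beta B).
Implicit Types (c r t : R).

(** The argument is (t - c) / r, written in the form that [smooth_affine] and [is_derive_affine]
    accept. *)
Definition scaled_step c r t : R := S (r^-1 * t + - (c / r)).
Definition scaled_bump c r t : R := beta (r^-1 * t + - (c / r)) * r^-1.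

Lemma scaled_step_smooth c r : smooth (scaled_step c r).
Proof. exact: (smooth_comp (step_smooth sp) (smooth_affine _ _)). Qed.

Lemma scaled_bump_smooth c r : smooth (scaled_bump c r).
Proof.
apply: smoothM (smooth_cst _).
exact: (smooth_comp (step_deriv_smooth sp) (smooth_affine _ _)).
Qed.

Lemma scaled_step_derive c r t :
  is_derive t 1 (scaled_step c r) (scaled_bump c r t).
Proof.
exact: (is_derive1_comp (step_deriv sp _) (is_derive_affine r^-1 (- (c / r)) t)).
Qed.

Lemma scaled_step_left c r t : 0 < r -> t <= c -> scaled_step c r t = 0.
Proof.
by move=> r0 tc; apply: (step_left sp); rewrite mulrC -mulrBl pmulr_lle0 ?invr_gt0// subr_le0.
Qed.

Lemma scaled_step_right c r t : 0 < r -> c + r <= t -> scaled_step c r t = 1.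
Proof.
move=> r0 tc; apply: (step_right sp); rewrite mulrC -mulrBl ler_pdivlMr// mul1r.
by rewrite lerBrDl.
Qed.

Lemma scaled_bump_supp c r t : 0 < r -> ~~ (c <= t <= c + r) ->
  scaled_bump c r t = 0.
Proof.
move=> r0 tc; rewrite /scaled_bump (step_deriv_supp sp) ?mul0r//.
apply: contra tc; rewrite mulrC -mulrBl pmulr_lge0 ?invr_gt0// subr_ge0.
by rewrite ler_pdivrMr// mul1r lerBlDl.
Qed.

Lemma scaled_bump_ge0 c r t : 0 < r -> 0 <= scaled_bump c r t.
Proof.
move=> r0; apply: mulr_ge0; last by rewrite invr_ge0 ltW.
by have /andP[] := step_deriv_range sp (r^-1 * t + - (c / r)).
Qed.

Lemma scaled_bump_le c r t : 0 < r -> scaled_bump c r t <= B / r.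
Proof.
move=> r0; apply: ler_wpM2r; first by rewrite invr_ge0 ltW.
by have /andP[] := step_deriv_range sp (r^-1 * t + - (c / r)).
Qed.

Lemma scaled_bump_measurable c r : measurable_fun setT (scaled_bump c r).
Proof.
apply: continuous_measurable_fun.
exact: Ck1_continuous (scaled_bump_smooth c r 0).
Qed.

Lemma scaled_bump_integral c r : 0 < r ->
  (\int[@lebesgue_measure R]_t (scaled_bump c r t)%:E = 1)%E.
Proof.
move=> r0; have cr : c < c + r by rewrite ltrDl.
have cs : continuous (scaled_step c r).
  exact: Ck1_continuous (scaled_step_smooth c r 0).
transitivity (\int[@lebesgue_measure R]_(t in `[c, (c + r)%R]) (scaled_bump c r t)%:E)%E.
  rewrite [RHS]integral_mkcond; apply: eq_integral => t _.
  rewrite patchE; case: ifPn => //; rewrite notin_setE /= in_itv /= => /negP tc.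
  by rewrite scaled_bump_supp.
rewrite (@continuous_FTC2 _ _ (scaled_step c r))//.
- by rewrite scaled_step_right// scaled_step_left// sube0.
- apply: continuous_subspaceT.
  exact: Ck1_continuous (scaled_bump_smooth c r 0).
- split.
  + by move=> t _; have [] := scaled_step_derive c r t.
  + by apply: cvg_at_right_filter; exact: cs.
  + by apply: cvg_at_left_filter; exact: cs.
- by move=> t _; rewrite derive1E; have [_] := scaled_step_derive c r t.
Qed.

End scaled_step.

Lemma integrable_cube_supp {R : realType} n (f : 'rV[R]_n -> R) c r :
  0 <= r -> measurable_fun setT f -> continuous f ->
  (forall x, ~ cube c r x -> f x = 0) ->
  (lebesgue_rV n).-integrable setT (EFin \o f).
Proof.
move=> r0 mf cf f0.
have -> : EFin \o f = (EFin \o f) \_ (cube c r).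
  apply/funext => x; rewrite patchE; case: ifPn => //.
  by rewrite notin_setE => /f0 /= ->.
apply/(integrable_mkcond _ (@cube_measurable R n c r)).
apply: (measurable_bounded_integrable (@cube_measurable R n c r)).
- have : (lebesgue_rV n (cube c r) < +oo)%E by rewrite cube_volume// ltry.
  exact.
- exact: measurable_funTS.
- have : bounded_set (f @` cube c r).
    apply: compact_bounded; apply: continuous_compact.
      exact: continuous_subspaceT.
    exact: cube_compact.
  move=> [M [Mr MP]]; exists M; split=> // x Mx y yc.
  by apply: MP => //; exists y.
Qed.

(** * Testing the weak derivative *)

Section weak_partial_bound.
Context {R : realType} {n : nat}.
Local Notation mu := (@lebesgue_rV R n).

Lemma L1loc_integrable (g : 'rV[R]_n -> R) c r : L1loc g ->
  mu.-integrable (cube c r) (EFin \o g).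
Proof.
move=> [mg gK]; apply/integrableP; split.
  by apply/measurable_EFinP; exact: measurable_funTS.
exact: gK (@cube_compact _ _ _ _).
Qed.

(** The only point where the integration by parts identity is invoked; from here on only the support
    and the size of the test function matter. *)
Lemma weak_partial_bound i (u g phi : 'rV[R]_n -> R) c r K :
  weak_partial i u g -> test_function phi -> measurable_fun setT phi ->
  (forall x, ~ cube c r x -> phi x = 0) -> (forall x, `|phi x| <= K) ->
  `|\int[mu]_x (u x * partial i phi x)| <= K * \int[mu]_(x in cube c r) `|g x|.
Proof.
move=> [Lg wg] tphi mphi phi0 phiK.
have mc := @cube_measurable R n c r.
have ig := L1loc_integrable c r Lg.
have ing : mu.-integrable (cube c r) (EFin \o (fun x => `|g x|)).
  exact: integrable_abse ig.
rewrite {1}/Rintegral wg// fineN normrN -[fine _]/(\int[mu]_x (g x * phi x)).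
have -> : \int[mu]_x (g x * phi x) = \int[mu]_(x in cube c r) (g x * phi x).
  rewrite [RHS]Rintegral_mkcond; apply: eq_Rintegral => x _.
  by rewrite patchE; case: ifPn => //; rewrite notin_setE => /phi0 ->; rewrite mulr0.
have igp : mu.-integrable (cube c r) (EFin \o (fun x => g x * phi x)).
  apply: (le_integrable mc _ _ (integrableZl mc K ing)).
    apply/measurable_EFinP; apply: measurable_funM.
      by apply: measurable_funTS; case: Lg.
    exact: measurable_funTS.
  move=> x _ /=; rewrite lee_fin !normrM normr_id mulrC ler_wpM2r//.
  by rewrite (le_trans (phiK x))// ler_norm.
apply: (le_trans (le_normr_Rintegral mc igp)).
rewrite -RintegralZl//; apply: le_Rintegral => //.
- exact: integrable_abse igp.
- exact: (integrableZl mc K ing).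
- by move=> x _; rewrite normrM mulrC ler_wpM2r.
Qed.

End weak_partial_bound.

(** * Weighted means over nested cubes *)

Section cube_bump.
Context {R : realType} {n : nat}.
Context (S beta : R -> R) (B : R) (sp : step_profile S beta B).
Local Notation mu := (@lebesgue_rV R n).
Implicit Types (c x : 'rV[R]_n) (r : R) (u : 'rV[R]_n -> R).

Definition cube_bump c r : 'rV[R]_n -> R :=
  prodfun (fun i => scaled_bump beta (c ord0 i) r).

Definition cube_mean u c r : R := \int[mu]_x (u x * cube_bump c r x).

Lemma cube_bump_ge0 c r x : 0 < r -> 0 <= cube_bump c r x.
Proof. by move=> r0; apply: prodr_ge0 => i _; exact: (scaled_bump_ge0 sp). Qed.

Lemma cube_bump_supp c r x : 0 < r -> ~ cube c r x -> cube_bump c r x = 0.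
Proof.
move=> r0; apply: prodfun_supp => i t; exact: (scaled_bump_supp sp r0).
Qed.

Lemma cube_bump_continuous c r : continuous (cube_bump c r).
Proof.
apply: prodfun_continuous => i.
exact: Ck1_continuous (scaled_bump_smooth sp _ _ 0).
Qed.

Lemma cube_bump_measurable c r : measurable_fun setT (cube_bump c r).
Proof. by apply: measurable_prodfun => i; exact: scaled_bump_measurable sp _ _. Qed.

Lemma cube_bump_integral c r : 0 < r -> \int[mu]_x cube_bump c r x = 1.
Proof.
move=> r0; rewrite /Rintegral integral_prodfun// => i.
- exact: scaled_bump_measurable sp _ _.
- by move=> t; exact: (scaled_bump_ge0 sp).
- exact: (scaled_bump_integral sp).
Qed.

(* [cube_bump c r - cube_bump c' (r / 2)] is a divergence: change the factors
   one coordinate at a time; the difference of two one-dimensional bumps is the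
   derivative of a difference of steps, which vanishes off the larger interval. *)
Lemma cube_mean_step u (g : 'I_n -> 'rV[R]_n -> R) c c' r :
  continuous u -> measurable_fun setT u ->
  (forall i, weak_partial i u (g i)) -> 0 < r ->
  (forall i, c ord0 i <= c' ord0 i /\ c' ord0 i + r / 2 <= c ord0 i + r) ->
  `|cube_mean u c r - cube_mean u c' (r / 2)| <=
  (2 * B / r) ^+ n.-1 * \sum_i \int[mu]_(x in cube c r) `|g i x|.
Proof.
move=> cu mu_ wg r0 cc'.
have r20 : 0 < r / 2 by rewrite divr_gt0.
pose a i := scaled_bump beta (c ord0 i) r.
pose b i := scaled_bump beta (c' ord0 i) (r / 2).
pose A i := scaled_step S (c ord0 i) r \- scaled_step S (c' ord0 i) (r / 2).
(* [G] interpolates from the bump of the large cube, at 0, to that of the small one, at [n]. In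
   [h i] the antiderivative [A i] of [a i - b i] takes place [i], so that [partial i] of its product
   is [G i - G i.+1]. *)
pose G k := prodfun (fun j : 'I_n => if (j < k)%N then b j else a j).
pose h (i : 'I_n) := fun j : 'I_n => if (j < i)%N then b j else if j == i then A j else a j.
have sa i : smooth (a i) by exact: scaled_bump_smooth sp _ _.
have sb i : smooth (b i) by exact: scaled_bump_smooth sp _ _.
have sA i : smooth (A i).
  have -> : A i = scaled_step S (c ord0 i) r \+
      (fun=> -1) \* scaled_step S (c' ord0 i) (r / 2).
    by apply/funext => t /=; rewrite mulN1r.
  apply: smoothD; first exact: scaled_step_smooth sp _ _.
  apply: smoothM; first exact: smooth_cst.
  exact: scaled_step_smooth sp _ _.
have dA i (t : R) : is_derive t 1 (A i) (a i t - b i t).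
  by apply: is_deriveB; exact: scaled_step_derive sp _ _ _.
have supp_a i t : ~~ (c ord0 i <= t <= c ord0 i + r) -> a i t = 0.
  exact: (scaled_bump_supp sp r0).
have supp_b i t : ~~ (c ord0 i <= t <= c ord0 i + r) -> b i t = 0.
  move=> tc; apply: (scaled_bump_supp sp r20); apply: contra tc => /andP[h1 h2].
  by have [h3 h4] := cc' i; rewrite (le_trans h3 h1) (le_trans h2 h4).
have supp_A i t : ~~ (c ord0 i <= t <= c ord0 i + r) -> A i t = 0.
  have [h3 h4] := cc' i.
  rewrite negb_and -!ltNge => /orP[/ltW tc|/ltW tc]; rewrite /A /=.
    by rewrite !(scaled_step_left sp) ?subrr// (le_trans tc).
  by rewrite !(scaled_step_right sp) ?subrr// (le_trans h4).
have bnd_A i t : `|A i t| <= 1.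
  rewrite /A /=.
  have /andP[h1 h2] := step_range sp (r^-1 * t + - (c ord0 i / r)).
  have /andP[h3 h4] := step_range sp ((r / 2)^-1 * t + - (c' ord0 i / (r / 2))).
  by rewrite /scaled_step ler_norml; apply/andP; split; lra.
(* This height of the narrow bump also dominates the height [B / r] of the wide one. *)
have bnd_b i t : `|b i t| <= 2 * B / r.
  rewrite ger0_norm ?(scaled_bump_ge0 sp)//.
  apply: le_trans (scaled_bump_le sp _ _ r20) _.
  by rewrite invf_div mulrA [B * _]mulrC.
have bnd_a i t : `|a i t| <= 2 * B / r.
  rewrite ger0_norm ?(scaled_bump_ge0 sp)//.
  apply: le_trans (scaled_bump_le sp _ _ r0) _.
  have /andP[h1 h2] := step_deriv_range sp 0.
  by apply: ler_wpM2r; [rewrite invr_ge0 ltW|lra].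
have sG k i : smooth (if (nat_of_ord i < k)%N then b i else a i) by case: ifP.
have sh i j : smooth (h i j) by rewrite /h; case: ifP => // _; case: ifP.
have mh (f : 'I_n -> R -> R) : (forall i, smooth (f i)) -> measurable_fun setT (prodfun f).
  move=> sf; apply: measurable_prodfun => i; apply: continuous_measurable_fun.
  exact: Ck1_continuous (sf i 0).
have h0 i x : ~ cube c r x -> prodfun (h i) x = 0.
  apply: prodfun_supp => j t tc; rewrite /h.
  by case: ifP => _; [exact: supp_b|case: ifP => _; [exact: supp_A|exact: supp_a]].
have G0 k x : ~ cube c r x -> G k x = 0.
  apply: prodfun_supp => j t tc.
  by case: ifP => _; [exact: supp_b|exact: supp_a].
have iG k : mu.-integrable setT (EFin \o (fun x => u x * G k x)).
  apply: (@integrable_cube_supp _ _ _ c r (ltW r0)).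
  - apply: measurable_funM => //; exact: mh.
  - have cG : continuous (G k).
      by apply: prodfun_continuous => i; exact: Ck1_continuous (sG k i 0).
    by move=> x; exact: (continuousM (cu x) (cG x)).
  - by move=> x /G0 ->; rewrite mulr0.
have GE (i : 'I_n) x : partial i (prodfun (h i)) x = G i x - G i.+1 x.
  have dh : is_derive (x ord0 i) 1 (h i i) (a i (x ord0 i) - b i (x ord0 i)).
    by rewrite /h ltnn eqxx.
  have [_ dE] := is_derive_prodfun dh; rewrite /partial dE.
  rewrite /G /prodfun [X in _ = X - _](bigD1 i)//= [X in _ = _ - X](bigD1 i)//=.
  rewrite ltnn ltnSn [X in _ = X - _ * _](_ : _ = a i (x ord0 i) *
     \prod_(j < n | j != i) h i j (x ord0 j)); last first.
    congr (_ * _); apply: eq_bigr => j /negbTE ji; rewrite /h ji; by case: ifP.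
  rewrite [X in _ = _ - _ * X](_ : _ = \prod_(j < n | j != i) h i j (x ord0 j)).
    by rewrite mulrBl.
  apply: eq_bigr => j ji; rewrite /h (negbTE ji) ltnS leq_eqVlt.
  by rewrite (negbTE (ji : nat_of_ord j != i)) /=.
have -> : cube_mean u c r = \int[mu]_x (u x * G 0 x).
  by apply: eq_Rintegral => x _; rewrite /G.
have -> : cube_mean u c' (r / 2) = \int[mu]_x (u x * G n x).
  apply: eq_Rintegral => x _; congr (_ * _); apply: eq_bigr => i _.
  by rewrite ltn_ord.
rewrite distrC -(telescope_sumr (fun k => \int[mu]_x (u x * G k x)))// big_mkord.
apply: le_trans (ler_norm_sum _ _ _) _; rewrite mulr_sumr; apply: ler_sum => i _.
rewrite distrC -RintegralB//.
have -> : \int[mu]_x (u x * G i x - u x * G i.+1 x) =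
    \int[mu]_x (u x * partial i (prodfun (h i)) x).
  by apply: eq_Rintegral => x _; rewrite GE mulrBr.
apply: weak_partial_bound => //.
- exact: test_function_prodfun (h0 i).
- exact: mh.
- exact: h0.
- move=> x; rewrite normr_prod (bigD1 i)//= {1}/h ltnn eqxx.
  (* The factor [A i] is bounded by 1, not by a bump height: this gains one power of [r]. *)
  have -> : (2 * B / r) ^+ n.-1 = 1 * \prod_(j < n | j != i) (2 * B / r).
    rewrite mul1r prodr_const; congr (_ ^+ _).
    by rewrite cardC1 card_ord.
  apply: ler_pM => //; first exact: prodr_ge0.
  apply: ler_prod => j ji; rewrite normr_ge0 /= /h (negbTE ji).
  by case: ifP.
Qed.

End cube_bump.

(** * The sup norm through coordinates *)

Section sup_norm.
Context {R : realType} {n : nat}.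
Implicit Types (x : 'rV[R]_n) (e : R).

Lemma coord_le_norm x i : `|x ord0 i| <= `|x|.
Proof.
by rewrite (_ : `|x| = mx_norm x)// mx_normrE; apply/bigmax_geP; right => /=; exists (ord0, i).
Qed.

Lemma norm_le_coord x e : 0 <= e -> (forall i, `|x ord0 i| <= e) -> `|x| <= e.
Proof.
move=> e0 xe; rewrite (_ : `|x| = mx_norm x)// mx_normrE; apply/bigmax_leP; split=> // -[i j] _ /=.
by rewrite (ord1 i).
Qed.

Lemma norm_eq_coord x : x != 0 -> exists i, `|x| = `|x ord0 i|.
Proof.
move=> x0; have [|[i j] /= xij] := @mx_norm_neq0 _ _ _ x.
  by apply: contra x0 => /eqP h; apply/eqP; exact: mx_norm_eq0.
by exists j; rewrite [LHS]xij (ord1 i).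
Qed.

End sup_norm.

(** * Hoelder's inequality on a cube, and means at vanishing scale *)

Section morrey.
Context {R : realType} {n : nat}.
Local Notation mu := (@lebesgue_rV R n).
Implicit Types (c x : 'rV[R]_n) (r p : R) (u : 'rV[R]_n -> R).

(** [G] is only a majorant of [|g| ^ p], so that one energy density serves all the partial
    derivatives. *)
Lemma hoelder_cube (g G : 'rV[R]_n -> R) c r p : 1 < p -> 0 <= r ->
  measurable_fun setT g -> (forall x, `|g x| `^ p <= G x) ->
  mu.-integrable setT (EFin \o G) ->
  \int[mu]_(x in cube c r) `|g x| <=
  (r ^+ n) `^ (1 - p^-1) * (\int[mu]_(x in cube c r) G x) `^ p^-1.
Proof.
move=> p1 r0 mg gG iG; have mc := @cube_measurable R n c r.
have p0 : 0 < p by rewrite (lt_trans _ p1).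
have q0 : 0 < 1 - p^-1 by rewrite subr_gt0 invf_lt1.
pose I : 'rV[R]_n -> R := \1_(cube c r).
have mI : measurable_fun setT I by exact: measurable_indic.
have iGc : mu.-integrable (cube c r) (EFin \o G) by exact: integrableS iG.
(* The indicator goes into both factors: it localises the norm of [g] and, being idempotent, leaves
   the left side an integral over the cube. *)
have := @hoelder _ _ _ mu (g \* I) I p (1 - p^-1)^-1
  (measurable_funM mg mI) mI p0.
rewrite invr_gt0 q0 invrK addrC subrK => /(_ isT erefl).
have IE x : I x = if x \in cube c r then 1 else 0.
  by rewrite /I indicE; case: (x \in _).
have -> : Lnorm mu 1 (EFin \o ((g \* I) \* I)%R) =
    (\int[mu]_(x in cube c r) `|g x|%:E)%E.
  rewrite Lnorm1 [RHS]integral_mkcond; apply: eq_integral => x _.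
  rewrite patchE /= IE; case: ifP => _; first by rewrite !mulr1.
  by rewrite !mulr0 normr0.
have -> : Lnorm mu (1 - p^-1)^-1%:E (EFin \o I) = ((r ^+ n) `^ (1 - p^-1))%:E.
  rewrite unlock invrK -poweR_EFin -(cube_volume c r0) -[in RHS](setIT (cube c r)).
  rewrite -integral_indic//; congr (_ `^ _)%E; apply: eq_integral => x _.
  rewrite poweR_EFin -/(I x) IE; case: ifP => _; first by rewrite normr1 powR1.
  by rewrite normr0 powR0// invr_neq0// gt_eqF.
have G0 x : 0 <= G x by rewrite (le_trans _ (gG x))// powR_ge0.
have EG : ((\int[mu]_(x in cube c r) G x)%:E = \int[mu]_(x in cube c r) (G x)%:E)%E.
  by rewrite /Rintegral fineK// (integrable_fin_num mc iGc).
have Np : (Lnorm mu p%:E (EFin \o (g \* I)%R) <=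
    ((\int[mu]_(x in cube c r) G x) `^ p^-1)%:E)%E.
  rewrite unlock -poweR_EFin; apply: gt0_ler_poweR.
  - by rewrite invr_ge0 ltW.
  - by rewrite in_itv/= leey andbT integral_ge0// => x _; exact: poweR_ge0.
  - by rewrite in_itv/= leey andbT lee_fin Rintegral_ge0.
  rewrite EG [leRHS]integral_mkcond; apply: ge0_le_integral => //.
  - by move=> x _; exact: poweR_ge0.
  - apply: (measurableT_comp (measurable_poweR p)).
    apply: measurableT_comp => //; apply/measurable_EFinP; exact: measurable_funM.
  - apply/(measurable_restrictT _ mc)/measurable_EFinP.
    by case/integrableP : iGc => /measurable_EFinP.
  - move=> x _; rewrite patchE /= IE; case: ifP => _.
      by rewrite mulr1 lee_fin gG.
    by rewrite mulr0 normr0 powR0 ?gt_eqF.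
move=> H; have {}H := le_trans H (lee_wpmul2r (_ : 0 <= _)%E Np).
have {}H : (\int[mu]_(x in cube c r) `|g x|%:E <=
    ((r ^+ n) `^ (1 - p^-1) * (\int[mu]_(x in cube c r) G x) `^ p^-1)%:E)%E.
  by rewrite mulrC EFinM; apply: H; rewrite lee_fin powR_ge0.
rewrite -lee_fin /Rintegral fineK// ge0_fin_numE ?(le_lt_trans H) ?ltry//.
exact: integral_ge0.
Qed.

(** The mean has nonnegative weights of total mass 1, all at points within [r] of [x]. The position
    of [x] in the cube is left free, as shrinking cubes need not be centred at it. *)
Lemma cube_mean_cvg (S beta : R -> R) (B : R) u x (e : R) :
  step_profile S beta B -> measurable_fun setT u -> continuous u -> 0 < e ->
  exists2 d, 0 < d & forall c r, 0 < r < d -> cube c r x ->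
    `|u x - cube_mean beta u c r| <= e.
Proof.
move=> sp mu_ cu e0.
have /nbhs_ballP[d /= d0 xd] : nbhs x [set y | `|u x - u y| <= e].
  by have /cvgrPdist_le := cu x; exact.
exists d => // c r /andP[r0 rd] xc.
have bS y : ~ cube c r y -> cube_bump beta c r y = 0 by exact: (cube_bump_supp sp).
have mb := @cube_bump_measurable R n _ _ _ sp c r.
have cb := @cube_bump_continuous R n _ _ _ sp c r.
have iub : mu.-integrable setT (EFin \o (fun y => u y * cube_bump beta c r y)).
  apply: (@integrable_cube_supp _ _ _ c r (ltW r0)).
  - exact: measurable_funM.
  - by move=> y; exact: (continuousM (cu y) (cb y)).
  - by move=> y /bS ->; rewrite mulr0.
have ib : mu.-integrable setT (EFin \o cube_bump beta c r).
  by apply: (@integrable_cube_supp _ _ _ c r (ltW r0)).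
have iZ k : mu.-integrable setT (EFin \o (fun y => k * cube_bump beta c r y)).
  exact: (integrableZl measurableT k ib).
have -> : u x = \int[mu]_y (u x * cube_bump beta c r y).
  by rewrite RintegralZl// (cube_bump_integral sp _ r0) mulr1.
rewrite -RintegralB//.
have iD : mu.-integrable setT (EFin \o (fun y => u x * cube_bump beta c r y - u y * cube_bump beta c r y)).
  exact: (integrableB measurableT (iZ _) iub).
apply: (le_trans (le_normr_Rintegral measurableT iD)).
have -> : e = \int[mu]_y (e * cube_bump beta c r y).
  by rewrite RintegralZl// (cube_bump_integral sp _ r0) mulr1.
apply: le_Rintegral => //; first exact: integrable_abse iD.
move=> y _; rewrite -mulrBl normrM [X in _ * X]ger0_norm; last first.
  exact: (cube_bump_ge0 sp).
have [yc|/bS ->] := pselect (cube c r y); last by rewrite !mulr0.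
apply: ler_wpM2r; first exact: (cube_bump_ge0 sp).
apply: xd; rewrite -ball_normE /=; apply: le_lt_trans rd.
apply: norm_le_coord; first exact: ltW.
move=> i; rewrite !mxE; have := xc i; have := yc i.
by rewrite ler_norml => /andP[h1 h2] /andP[h3 h4]; apply/andP; split; lra.
Qed.

End morrey.

(** * Morrey's inequality on a cube *)

Section morrey_estimate.
Context {R : realType} {n : nat}.
Local Notation mu := (@lebesgue_rV R n).
Implicit Types (c x : 'rV[R]_n) (r p : R) (u : 'rV[R]_n -> R).

Lemma le_Rintegral_set (G : 'rV[R]_n -> R) A A' :
  measurable A -> measurable A' -> A `<=` A' ->
  (forall x, 0 <= G x) -> mu.-integrable setT (EFin \o G) ->
  \int[mu]_(x in A) G x <= \int[mu]_(x in A') G x.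
Proof.
move=> mA mA' AA' G0 iG.
have fin D : measurable D -> ((\int[mu]_(x in D) G x)%:E = \int[mu]_(x in D) (G x)%:E)%E.
  move=> mD; rewrite /Rintegral fineK//; apply: (integrable_fin_num mD).
  exact: integrableS iG.
rewrite -lee_fin !fin//; apply: ge0_subset_integral => //.
  apply/measurable_EFinP; apply: measurable_funTS.
  by case/integrableP : iG => /measurable_EFinP.
by move=> x _; rewrite lee_fin.
Qed.

(** The power 1 - n of the test field and n (1 - 1/p) from Hoelder's inequality add up to the
    Hoelder exponent. *)
Lemma scaling_exponent r p (B : R) : (0 < n)%N -> 0 < r -> 0 <= B ->
  (2 * B / r) ^+ n.-1 * (r ^+ n) `^ (1 - p^-1) =
  (2 * B) ^+ n.-1 * r `^ (1 - n%:R / p).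
Proof.
move=> n0 r0 B0; have r0' := ltW r0.
rewrite expr_div_n -mulrA; congr (_ * _).
rewrite -!(powR_mulrn _ r0') -powRN -powRrM -powRD; last first.
  by apply/implyP => _; rewrite gt_eqF.
congr (_ `^ _); have -> : n.-1%:R = n%:R - 1 :> R by rewrite -subn1 natrB.
ring.
Qed.

Lemma morrey_mean (S beta : R -> R) (B : R) u (g : 'I_n -> 'rV[R]_n -> R) G p :
  step_profile S beta B -> (0 < n)%N -> n%:R < p ->
  continuous u -> measurable_fun setT u ->
  (forall i, weak_partial i u (g i)) ->
  (forall i x, `|g i x| `^ p <= G x) -> mu.-integrable setT (EFin \o G) ->
  exists2 D, 0 <= D & forall c r x, 0 < r -> cube c r x ->
   `|u x - cube_mean beta u c r| <=
   D * r `^ (1 - n%:R / p) * (\int[mu]_(x in cube c r) G x) `^ p^-1.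
Proof.
move=> sp n0 np cu mu_ wg gG iG.
have B0 : 0 <= B by have /andP[h0 h1] := step_deriv_range sp 0; exact: le_trans h1.
have n1 : 1 <= n%:R :> R by rewrite ler1n.
have p1 : 1 < p by exact: le_lt_trans np.
have p0 : 0 < p by exact: lt_trans p1.
have G0 x : 0 <= G x by rewrite (le_trans _ (gG (Ordinal n0) x))// powR_ge0.
set a := 1 - n%:R / p.
have a0 : 0 < a by rewrite subr_gt0 ltr_pdivrMr// mul1r.
pose C := (2 * B) ^+ n.-1 * n%:R.
have C0 : 0 <= C by rewrite mulr_ge0// exprn_ge0// mulr_ge0.
pose theta := 2^-1 `^ a : R.
have half r : 0 < r -> (r / 2) `^ a = theta * r `^ a.
  by move=> r0; rewrite powRM ?invr_ge0 ?(ltW r0)// mulrC.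
have theta1 : theta < 1.
  have E1 : 1 = 1 `^ a by rewrite powR1.
  rewrite /theta [ltRHS]E1 gt0_ltr_powR// ?nnegrE ?invr_ge0//.
  by rewrite invf_lt1// ltr1n.
(* Since [(r / 2) ^ a = theta * r ^ a], this choice turns [C * r ^ a] into [D] times the drop of
   [r ^ a] under halving, and the sum over scales telescopes. *)
pose D := C / (1 - theta).
have D0 : 0 <= D by rewrite divr_ge0// subr_ge0 ltW.
have CD : C = D * (1 - theta) by rewrite divfK// gt_eqF// subr_gt0.
pose e c r := (\int[mu]_(x in cube c r) G x) `^ p^-1.
have e0 c r : 0 <= e c r by exact: powR_ge0.
have step c c' r : 0 < r ->
    (forall i, c ord0 i <= c' ord0 i /\ c' ord0 i + r / 2 <= c ord0 i + r) ->
    `|cube_mean beta u c r - cube_mean beta u c' (r / 2)| <=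
    D * (r `^ a - (r / 2) `^ a) * e c r.
  move=> r0 cc'; apply: le_trans (cube_mean_step sp cu mu_ wg r0 cc') _.
  rewrite half// [X in _ <= _ * X * _](_ : _ = (1 - theta) * r `^ a); last by ring.
  rewrite mulrA -CD.
  apply: (@le_trans _ _ ((2 * B / r) ^+ n.-1 *
      \sum_(i < n) ((r ^+ n) `^ (1 - p^-1) * e c r))).
    apply: ler_wpM2l.
      by rewrite exprn_ge0// divr_ge0 ?(ltW r0)// mulr_ge0.
    apply: ler_sum => i _; apply: hoelder_cube => //; first exact: ltW.
    by case: (wg i) => -[].
  rewrite sumr_const card_ord -[(_ * e c r) *+ n]mulr_natr !mulrA.
  rewrite scaling_exponent// -/a /C.
  by rewrite le_eqVlt; apply/orP; left; apply/eqP; ring.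
exists D => // c r x r0 xc; rewrite -/(e c r).
have chain k : forall c r, 0 < r -> cube c r x -> exists c', cube c' (r / 2 ^+ k) x /\
    `|u x - cube_mean beta u c r| <=
    D * (r `^ a - (r / 2 ^+ k) `^ a) * e c r +
    `|u x - cube_mean beta u c' (r / 2 ^+ k)|.
  elim: k => [|k IH] {}c {}r {}r0 {}xc.
    by exists c; rewrite expr0 divr1 subrr mulr0 mul0r add0r.
  (* Corner of the image of the cube under the homothety of ratio 1/2 centred at [x]: it contains
     [x] and lies in the old cube. *)
  pose c1 : 'rV[R]_n := \row_i ((c ord0 i + x ord0 i) / 2).
  have r20 : 0 < r / 2 by rewrite divr_gt0.
  have xc1 : cube c1 (r / 2) x.
    by move=> i; rewrite !mxE; have /andP[h1 h2] := xc i; apply/andP; split; lra.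
  have cc1 i : c ord0 i <= c1 ord0 i /\ c1 ord0 i + r / 2 <= c ord0 i + r.
    by rewrite !mxE; have /andP[h1 h2] := xc i; split; lra.
  have [c' [xc' Hc']] := IH c1 (r / 2) r20 xc1.
  have E : r / 2 / 2 ^+ k = r / 2 ^+ k.+1 by rewrite exprS invfM mulrA.
  rewrite E in xc' Hc'; exists c'; split; first exact: xc'.
  have ec1 : e c1 (r / 2) <= e c r.
    apply: ge0_ler_powR.
    - by rewrite invr_ge0 ltW.
    - by rewrite nnegrE; apply: Rintegral_ge0.
    - by rewrite nnegrE; apply: Rintegral_ge0.
    apply: le_Rintegral_set => //; try exact: cube_measurable.
    move=> y yc i; have /andP[h1 h2] := yc i; have [h3 h4] := cc1 i.
    by apply/andP; split; lra.
  have mono : (r / 2 ^+ k.+1) `^ a <= (r / 2) `^ a.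
    apply: ge0_ler_powR; rewrite ?nnegrE ?(ltW a0) ?(ltW r20)//.
      by rewrite divr_ge0 ?(ltW r0)// exprn_ge0.
    rewrite -E ler_pdivrMr ?exprn_gt0// ler_peMr ?(ltW r20)//.
    by rewrite exprn_ege1// ler1n.
  have st := step c c1 r r0 cc1.
  (* Energies of smaller cubes are replaced by that of the initial one, so a common factor is left
     to telescope against. *)
  have h : D * ((r / 2) `^ a - (r / 2 ^+ k.+1) `^ a) * e c1 (r / 2) <=
      D * ((r / 2) `^ a - (r / 2 ^+ k.+1) `^ a) * e c r.
    by apply: ler_wpM2l => //; rewrite mulr_ge0// subr_ge0.
  apply: le_trans (ler_distD (cube_mean beta u c1 (r / 2)) _ _) _.
  rewrite [X in _ + X]distrC.
  apply: le_trans (lerD (le_trans Hc' (lerD h (lexx _))) st) _.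
  rewrite addrAC lerD2r -mulrDl -mulrDr ler_wpM2r// ler_wpM2l//.
  by rewrite addrC addrA subrK.
apply/ler_addgt0Pr => eps eps0.
have [d d0 Hd] := cube_mean_cvg x sp mu_ cu eps0.
have [k Hk] : exists k, r / 2 ^+ k < d.
  (* Enough because [r / d < m.+1 < 2 ^ m.+1]. *)
  pose m := Num.truncn (r / d); exists m.+1.
  have h : r / d < m.+1%:R by exact: truncnS_gt.
  rewrite ltr_pdivrMr ?exprn_gt0// -ltr_pdivrMl// mulrC (lt_trans h)//.
  by rewrite -natrX ltr_nat ltn_expl.
have [c' [xc' Hc']] := chain k c r r0 xc.
apply: (le_trans Hc'); apply: lerD.
  apply: ler_wpM2r => //; apply: ler_wpM2l => //.
  by rewrite gerBl powR_ge0.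
apply: Hd xc'; rewrite Hk andbT divr_gt0// exprn_gt0//.
Qed.

Lemma morrey_cube u p : (0 < n)%N -> n%:R < p -> D1p p u -> continuous u ->
  exists K G, [/\ 0 <= K, forall x : 'rV[R]_n, 0 <= G x,
    mu.-integrable setT (EFin \o G) &
    forall c r x y, 0 < r -> cube c r x -> cube c r y ->
      `|u x - u y| <=
      K * r `^ (1 - n%:R / p) * (\int[mu]_(x in cube c r) G x) `^ p^-1].
Proof.
move=> n0 np [[mu_ _] /= wu] cu.
have p1 : 1 <= p by rewrite (le_trans _ (ltW np))// ler1n.
have /choice[g gP] : forall i, exists g : 'rV[R]_n -> R,
    weak_partial i u g /\ g \in Lfun mu p%:E.
  by move=> i; have [g wg Lg] := wu i; exists g.
pose G x := \sum_(i < n) `|g i x| `^ p.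
have iG : mu.-integrable setT (EFin \o G).
  rewrite (_ : EFin \o G = fun x => (\sum_(i < n) (`|g i x| `^ p)%:E)%E).
    apply: integrable_sum => // i _; apply: Lfun_integrable => //.
    by have [] := gP i.
  by apply/funext => x; rewrite /= /G -sumEFin.
have gG i x : `|g i x| `^ p <= G x.
  rewrite /G (bigD1 i)//= lerDl; apply: sumr_ge0 => j _; exact: powR_ge0.
have [S [beta [B sp]]] := @step_profile_exists R.
have [D D0 HD] := morrey_mean sp n0 np cu mu_ (fun i => (gP i).1) gG iG.
exists (2 * D), G; split=> //; first by rewrite mulr_ge0.
  by move=> x; apply: sumr_ge0 => i _; exact: powR_ge0.
move=> c r x y r0 xc yc.
apply: le_trans (ler_distD (cube_mean beta u c r) _ _) _.
rewrite [`|_ - u y|]distrC; apply: le_trans (lerD (HD _ _ _ r0 xc) (HD _ _ _ r0 yc)) _.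
by rewrite le_eqVlt; apply/orP; left; apply/eqP; ring.
Qed.

End morrey_estimate.

(** * Small oscillation on small cubes and on distant cubes *)

Section local_oscillation.
Context {R : realType} {n : nat}.
Local Notation mu := (@lebesgue_rV R n).
Implicit Types (c x y : 'rV[R]_n) (r p : R) (u : 'rV[R]_n -> R).

(** Absolute continuity of the integral and decay of its tail come from one truncation, in position
    and in height at once. *)
Lemma energy_small (G : 'rV[R]_n -> R) (eta : R) : (0 < n)%N ->
  (forall x, 0 <= G x) -> mu.-integrable setT (EFin \o G) -> 0 < eta ->
  exists N d, [/\ 0 < N, 0 < d & forall c r, 0 < r ->
    r < d \/ (forall x, cube c r x -> N < `|x|) ->
    \int[mu]_(x in cube c r) G x <= eta].
Proof.
move=> n0 G0 iG eta0.
have mG : measurable_fun setT G by case/integrableP : iG => /measurable_EFinP.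
pose Q (k : nat) : set 'rV[R]_n := cube (const_mx (- k%:R)) (2 * k%:R).
have QP k x : Q k x <-> `|x| <= k%:R.
  split=> [xQ|xk i].
    apply: norm_le_coord => // i; have := xQ i; rewrite mxE ler_norml => /andP[h1 h2].
    by apply/andP; split; lra.
  have := le_trans (coord_le_norm x i) xk; rewrite mxE ler_norml => /andP[h1 h2].
  by apply/andP; split; lra.
(* By dominated convergence the energy of [A k] tends to [0]; off [A k] the
   density [G] is at most [k], which handles small cubes. *)
pose A k := ~` (Q k `&` [set x | G x <= k%:R]).
have mA k : measurable (A k).
  apply: measurableC; apply: measurableI; first exact: cube_measurable.
  rewrite -[X in measurable X]setTI.
  have -> : [set x | G x <= k%:R] = G @^-1` `]-oo, k%:R]%classic.
    by apply/seteqP; split=> x /=; rewrite in_itv.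
  exact: mG.
have [k Hk] : exists k, \int[mu]_(x in A k) G x <= eta / 2.
  pose f k x := ((EFin \o G) \_ (A k) x).
  have [] := @dominated_convergence _ _ _ mu setT measurableT f (cst 0%E) (EFin \o G).
  - move=> k; apply/(measurable_restrictT _ (mA k)).
    by apply/measurable_EFinP; exact: measurable_funTS.
  - exact: measurable_cst.
  - apply: aeW => x _; apply: cvg_near_cst.
    pose m := Num.truncn (`|x| + G x).
    have xm : `|x| + G x < m.+1%:R by exact: truncnS_gt.
    (* An index above both [|x|] and [G x] puts the fixed point [x] outside [A k]. *)
    exists m.+1 => // k /= mk; rewrite /f patchE ifF//; apply/negbTE; rewrite notin_setE.
    have kx : `|x| + G x <= k%:R by rewrite (le_trans (ltW xm))// ler_nat.
    apply; split; first by apply/QP; rewrite (le_trans _ kx)// lerDl.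
    by rewrite /= (le_trans _ kx)// lerDr.
  - exact: iG.
  - apply: aeW => x k _; rewrite /f patchE; case: ifP => _ /=.
      by rewrite ger0_norm.
    by rewrite normr0 lee_fin.
  move=> _ _ ; rewrite integral0 => /fine_cvgP[_ /cvgr0Pnorm_le/(_ (eta / 2))].
  rewrite divr_gt0// => /(_ isT)[k _ /(_ k (leqnn k))] /=.
  rewrite -integral_mkcond -/(Rintegral mu (A k) G) ger0_norm ?Rintegral_ge0//.
  by exists k.
(* The successor keeps [N] positive when [k = 0]. *)
pose N := k.+1%:R : R.
have N0 : 0 < N by rewrite ltr0n.
(* Off [A k] the energy is at most [N * r ^ n]; [r < 1] bounds it by [N * r], and the second term
   makes that at most [eta / 2]. *)
exists N, (Num.min 1 (eta / (2 * N))); split=> //.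
  by rewrite lt_min ltr01 divr_gt0// mulr_gt0.
move=> c r r0 rc; have mc := @cube_measurable R n c r.
have ic D : measurable D -> mu.-integrable D (EFin \o G) by move=> mD; exact: integrableS iG.
case: rc => [|cN].
- rewrite lt_min => /andP[r1 rd].
  have iA : mu.-integrable (cube c r) (EFin \o (G \_ (A k))).
    rewrite -restrict_EFin; apply/(integrable_restrict _ (mA k) mc); apply: ic.
    exact: measurableI.
  have iN : mu.-integrable (cube c r) (EFin \o (fun=> N)).
    apply: (measurable_bounded_integrable mc) => //.
      have : (lebesgue_rV n (cube c r) < +oo)%E by rewrite cube_volume ?(ltW r0)// ltry.
      exact.
    by exists N; split; [exact: num_real|move=> M NM x _ /=; rewrite gtr0_norm// ltW].
  apply: (@le_trans _ _ (\int[mu]_(x in cube c r) ((G \_ (A k)) x + N))).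
    apply: le_Rintegral => //; first exact: ic.
      exact: (integrableD mc iA iN).
    move=> x _; rewrite patchE; case: ifPn => [_|]; first by rewrite lerDl ltW.
    rewrite notin_setE add0r => /contrapT[_ /= Gk].
    by rewrite (le_trans Gk)// ler_nat.
  rewrite RintegralD// Rintegral_cst// -[fine _]/(fine (lebesgue_rV n (cube c r))).
  rewrite cube_volume ?(ltW r0)//= [leRHS]splitr; apply: lerD.
    rewrite -Rintegral_mkcondr; apply: le_trans Hk.
    by apply: (le_Rintegral_set _ _ _ G0 iG) => //; exact: measurableI.
  apply: (@le_trans _ _ (N * r)).
    rewrite ler_pM2l//; case: n n0 => // m _; rewrite exprS ler_piMr ?(ltW r0)//.
    by rewrite exprn_ile1 ?(ltW r0)// ltW.
  by move: rd; rewrite ltr_pdivlMr ?mulr_gt0// => /ltW; lra.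
- apply: le_trans (le_trans Hk _); last by rewrite ler_pdivrMr// ler_peMr ?(ltW eta0)// ler1n.
  apply: (le_Rintegral_set mc (mA k) _ G0 iG) => x xc; rewrite /A => -[/QP xk _].
  by have := cN x xc; rewrite ltNge (le_trans xk)// ler_nat.
Qed.

Lemma local_oscillation u p (eps : R) :
  (0 < n)%N -> n%:R < p -> D1p p u -> continuous u -> 0 < eps ->
  exists N d, [/\ 0 < N, 0 < d & forall c r x y, 0 < r ->
    cube c r x -> cube c r y ->
    r < d \/ (forall z, cube c r z -> N < `|z|) ->
    `|u x - u y| <= eps * r `^ (1 - n%:R / p)].
Proof.
move=> n0 np Du cu eps0.
have p0 : 0 < p by rewrite (le_lt_trans _ np).
have [K [G [K0 G0 iG HK]]] := morrey_cube n0 np Du cu.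
have K1 : 0 < K + 1 by rewrite ltr_wpDl.
(* The energy threshold is the [p]-th power of this number, undone by the root in Morrey's
   inequality; [K + 1] avoids dividing by 0. *)
have q0 : 0 < eps / (K + 1) by rewrite divr_gt0.
have [N [d [N0 d0 Hd]]] := energy_small n0 G0 iG (powR_gt0 p q0).
exists N, d; split=> // c r x y r0 xc yc rc.
apply: le_trans (HK c r x y r0 xc yc) _.
rewrite mulrAC ler_wpM2r ?powR_ge0//.
have h : (\int[mu]_(x in cube c r) G x) `^ p^-1 <= eps / (K + 1).
  rewrite [leRHS](_ : _ = ((eps / (K + 1)) `^ p) `^ p^-1); last first.
    by rewrite -powRrM mulfV ?gt_eqF// powRr1// ltW.
  apply: ge0_ler_powR (Hd c r r0 rc).
  - by rewrite invr_ge0 ltW.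
  - by rewrite nnegrE Rintegral_ge0.
  - by rewrite nnegrE powR_ge0.
apply: le_trans (ler_wpM2l K0 h) _.
by rewrite mulrA ler_pdivrMr// mulrC ler_pM2l// lerDl.
Qed.

End local_oscillation.

(** * Growth at infinity and oscillation over all pairs *)

Section global_oscillation.
Context {R : realType} {n : nat}.
Implicit Types (c x y z : 'rV[R]_n) (r p a : R) (u : 'rV[R]_n -> R).

Lemma bounded_on_ball u r : continuous u -> 0 <= r ->
  exists2 M, 0 <= M & forall x, `|x| <= r -> `|u x| <= M.
Proof.
move=> cu r0.
have : bounded_set (u @` cube (const_mx (- r)) (2 * r)).
  apply: compact_bounded; apply: continuous_compact.
    exact: continuous_subspaceT.
  exact: cube_compact.
move=> /ex_strict_bound_gt0[M M0 HM]; exists M; first exact: ltW.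
move=> x xr; apply/ltW/HM; exists x => // i.
have := le_trans (coord_le_norm x i) xr; rewrite mxE ler_norml => /andP[h1 h2].
by apply/andP; split; lra.
Qed.

(** The coordinatewise minimum serves as corner, the sup distance being the largest coordinate gap.
    The last clause keeps the cube far from the origin when [x] is. *)
Lemma cube_of_pair x y : x != y ->
  exists c, [/\ cube c `|x - y| x, cube c `|x - y| y &
    forall z, cube c `|x - y| z -> `|z - x| <= `|x - y|].
Proof.
move=> xy; exists (\row_i Num.min (x ord0 i) (y ord0 i)).
have h i := coord_le_norm (x - y) i.
split=> [i|i|z zc].
- have := h i; rewrite !mxE ler_norml minElt => /andP[h1 h2].
  by case: ifPn => ?; apply/andP; split; lra.
- have := h i; rewrite !mxE ler_norml minElt => /andP[h1 h2].
  by case: ifPn => ?; apply/andP; split; lra.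
- apply: norm_le_coord => // i; have := zc i; have := h i.
  rewrite !mxE !ler_norml minElt => /andP[h1 h2].
  by case: ifPn => ? /andP[h3 h4]; apply/andP; split; lra.
Qed.

(* The cube joins [x / 2] to [x] and stays off the ball of radius [|x| / 2]: in
   the coordinate [i] with [|x| = |x_i|] it only spans [x_i / 2] to [x_i]. *)
Lemma cube_of_half x : x != 0 ->
  exists c, [/\ cube c (`|x| / 2) x, cube c (`|x| / 2) (2^-1 *: x) &
    forall z, cube c (`|x| / 2) z -> `|x| / 2 <= `|z|].
Proof.
move=> x0.
pose c : 'rV[R]_n :=
  \row_i (if 0 <= x ord0 i then x ord0 i / 2 else x ord0 i / 2 - `|x| / 2).
exists c; split=> [i|i|z zc].
- have := coord_le_norm x i; rewrite /c !mxE ler_norml => /andP[h1 h2].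
  by case: ifPn => [?|]; rewrite -?ltNge => *; apply/andP; split; lra.
- have := coord_le_norm x i; rewrite /c !mxE ler_norml => /andP[h1 h2].
  by case: ifPn => [?|]; rewrite -?ltNge => *; apply/andP; split; lra.
- have [i xi] := norm_eq_coord x0.
  apply: le_trans (coord_le_norm z i); have := zc i.
  rewrite /c !mxE xi; case: ifPn => [xi0|]; last rewrite -ltNge => xi0.
    rewrite (ger0_norm xi0) => /andP[h1 _]; exact: le_trans (ler_norm _).
  rewrite (ltr0_norm xi0) => /andP[_ h2].
  by rewrite ler_normr; apply/orP; right; lra.
Qed.

(** Halve [x] until it enters the ball of radius [2 * N], where [u] is bounded. The costs
    [eps * (|x| / 2 ^ j) ^ a] form a geometric series of ratio [2^-1 ^ a], whose sum gives the
    coefficient. *)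
Lemma sublinear_growth u a (eps N : R) : 0 < a -> 0 < N -> 0 < eps -> continuous u ->
  (forall c r x y, 0 < r -> cube c r x -> cube c r y ->
    (forall z, cube c r z -> N < `|z|) -> `|u x - u y| <= eps * r `^ a) ->
  exists2 M, 0 <= M & forall x,
    `|u x| <= M + 2^-1 `^ a / (1 - 2^-1 `^ a) * eps * `|x| `^ a.
Proof.
move=> a0 N0 eps0 cu osc.
set theta := 2^-1 `^ a : R.
have theta1 : 0 < 1 - theta.
  have E1 : 1 = 1 `^ a by rewrite powR1.
  rewrite subr_gt0 /theta [ltRHS]E1 gt0_ltr_powR// ?nnegrE ?invr_ge0//.
  by rewrite invf_lt1// ltr1n.
set F := theta / (1 - theta).
have F0 : 0 <= F by rewrite divr_ge0 ?powR_ge0// ltW.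
(* Equivalently [theta + F * theta = F]: the cost of one halving plus the inductive bound at [x / 2]
   gives back the same [F]. *)
have FE : theta = F * (1 - theta) by rewrite divfK// gt_eqF.
have [M M0 HM] := bounded_on_ball cu (ltW (mulr_gt0 (ltr0n R 2) N0)).
exists M => // x.
suff H k : forall x, `|x| <= 2 ^+ k * (2 * N) -> `|u x| <= M + F * eps * `|x| `^ a.
  pose m := Num.truncn (`|x| / (2 * N)); apply: (H m.+1).
  have h : `|x| / (2 * N) < m.+1%:R by exact: truncnS_gt.
  rewrite -ler_pdivrMr ?mulr_gt0// ltW// (lt_trans h)//.
  by rewrite -natrX ltr_nat ltn_expl.
elim: k => [|k IH] {}x xk.
  rewrite expr0 mul1r in xk; apply: le_trans (HM x xk) _.
  by rewrite lerDl mulr_ge0 ?powR_ge0// mulr_ge0// ltW.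
have [xN|xN] := leP `|x| (2 * N).
  apply: le_trans (HM x xN) _.
  by rewrite lerDl mulr_ge0 ?powR_ge0// mulr_ge0// ltW.
have x0 : x != 0 by rewrite -normr_gt0 (lt_trans _ xN)// mulr_gt0.
have x2E : `|2^-1 *: x| = `|x| / 2 by rewrite normrZ gtr0_norm ?invr_gt0// mulrC.
have [c [xc x2c zc]] := cube_of_half x0.
have x20 : 0 < `|x| / 2 by rewrite divr_gt0// normr_gt0.
have {}osc : `|u x - u (2^-1 *: x)| <= eps * (`|x| / 2) `^ a.
  apply: osc xc x2c _ => // z /zc; apply: lt_le_trans.
  by rewrite ltr_pdivlMr// mulrC.
have {}IH : `|u (2^-1 *: x)| <= M + F * eps * (`|x| / 2) `^ a.
  rewrite -x2E; apply: IH; rewrite x2E ler_pdivrMr//.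
  by rewrite (le_trans xk)// exprS -mulrA mulrC.
have half : (`|x| / 2) `^ a = theta * `|x| `^ a.
  by rewrite powRM ?invr_ge0// mulrC.
have tri : `|u x| <= `|u x - u (2^-1 *: x)| + `|u (2^-1 *: x)|.
  by rewrite -[X in `|X| <= _](subrK (u (2^-1 *: x))) ler_normD.
apply: (le_trans tri); apply: le_trans (lerD osc IH) _.
rewrite half addrCA lerD2l le_eqVlt; apply/orP; left; apply/eqP.
rewrite [in X in X + _]FE; ring.
Qed.

(* Far pairs: either the segment's cube avoids a large ball, or both points are
   within [3 |x - y|] of the origin and the sublinear growth applies. *)
Lemma global_oscillation u p (eps : R) :
  (0 < n)%N -> n%:R < p -> D1p p u -> continuous u -> 0 < eps ->
  exists d L, 0 < d /\ forall x y, x != y ->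
    [\/ [/\ d <= `|x - y|, `|x| <= L & `|y| <= L] |
        `|u x - u y| <= eps * `|x - y| `^ (1 - n%:R / p)].
Proof.
move=> n0 np Du cu eps0.
have p0 : 0 < p by rewrite (le_lt_trans _ np).
have np1 : n%:R / p < 1 by rewrite ltr_pdivrMr// mul1r.
have np0 : 0 < n%:R / p by rewrite divr_gt0// ltr0n.
set a := 1 - n%:R / p.
have a0 : 0 < a by rewrite subr_gt0.
have a1 : a <= 1 by rewrite gerBl ltW.
set F := 2^-1 `^ a / (1 - 2^-1 `^ a) : R.
have F0 : 0 <= F.
  have E1 : 1 = 1 `^ a by rewrite powR1.
  rewrite divr_ge0 ?powR_ge0// subr_ge0 [leRHS]E1.
  by rewrite ge0_ler_powR ?(ltW a0) ?nnegrE ?invr_ge0// invf_le1// ler1n.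
(* Growth at two points of norm at most [3 * s] costs [6 * F * eps'], hence at most [eps / 2]; the
   added 12 keeps the divisor positive and [eps' <= eps]. *)
pose eps' := eps / (12 * F + 12).
have F12 : 0 < 12 * F + 12 by lra.
have eps'0 : 0 < eps' by rewrite divr_gt0.
have epsE : eps = eps' * (12 * F + 12) by rewrite divfK// gt_eqF.
have eps'eps : eps' <= eps.
  by rewrite epsE ler_peMr ?(ltW eps'0)//; lra.
have [N [d [N0 d0 osc]]] := local_oscillation n0 np Du cu eps'0.
have [M M0 HM] : exists2 M, 0 <= M & forall x, `|u x| <= M + F * eps' * `|x| `^ a.
  apply: (sublinear_growth a0 N0 eps'0 cu) => c r x y r0 xc yc zc.
  by apply: osc xc yc _ => //; right.
(* Beyond [T] the constant part [2 * M] of the growth bounds takes at most the other half, and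
   [N <= s]. *)
pose T := N + (4 * M / eps) `^ a^-1.
have NT : N <= T by rewrite lerDl powR_ge0.
have MT s : T <= s -> 4 * M / eps <= s `^ a.
  move=> Ts; have h0 : 0 <= 4 * M / eps by rewrite divr_ge0 ?(ltW eps0)// mulr_ge0.
  rewrite [leLHS](_ : _ = ((4 * M / eps) `^ a^-1) `^ a); last first.
    by rewrite -powRrM mulVf ?gt_eqF// powRr1.
  apply: ge0_ler_powR; rewrite ?nnegrE ?powR_ge0 ?(ltW a0)//.
    by rewrite (le_trans _ Ts)// (le_trans (ltW N0)).
  by rewrite (le_trans _ Ts)// lerDr ltW.
(* In the remaining case [|x| <= N + s] and [|y| <= |x| + s] with [s < T]. *)
exists d, (N + 2 * T); split=> // x y xy.
set s := `|x - y|.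
have s0 : 0 < s by rewrite normr_gt0 subr_eq0.
have sa0 : 0 <= s `^ a by exact: powR_ge0.
have [c [xc yc zc]] := cube_of_pair xy.
have near : s < d \/ (forall z, cube c s z -> N < `|z|) ->
    `|u x - u y| <= eps * s `^ a.
  move=> H; apply: le_trans (osc c s x y s0 xc yc H) _.
  by rewrite ler_wpM2r.
have [ds|sd] := leP d s; last by right; apply: near; left.
have [xN|xN] := leP `|x| (N + s); last first.
  right; apply: near; right=> z /zc zx.
  have := ler_normB z (z - x); rewrite opprB addrC subrK.
  by move: xN zx; rewrite -/s; lra.
have yx : `|y| <= `|x| + s.
  by have := ler_normB x (x - y); rewrite opprB addrC subrK.
have [Ts|sT] := leP T s; last by left; split=> //; lra.
right.
have sN : N <= s by exact: le_trans Ts.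
(* Here [|x| <= N + s <= 2 * s] and [|y| <= 3 * s]; the factor [3 ^ a] is at most 3 because
   [a <= 1]. *)
have bnd z : `|z| <= 3 * s -> `|z| `^ a <= 3 * s `^ a.
  move=> z3; apply: (@le_trans _ _ ((3 * s) `^ a)).
    by rewrite ge0_ler_powR ?(ltW a0) ?nnegrE// mulr_ge0// ltW.
  rewrite powRM ?(ltW s0)//; apply: ler_wpM2r => //.
  by rewrite -[leRHS]powRr1//; apply: ler_powR => //; rewrite ler1n.
have x3 : `|x| `^ a <= 3 * s `^ a by apply: bnd; lra.
have y3 : `|y| `^ a <= 3 * s `^ a by apply: bnd; lra.
have Fe0 : 0 <= F * eps' by rewrite mulr_ge0// ltW.
apply: le_trans (ler_normB _ _) _; apply: le_trans (lerD (HM x) (HM y)) _.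
have h1 := ler_wpM2l Fe0 x3; have h2 := ler_wpM2l Fe0 y3.
have h3 : 4 * M <= eps * s `^ a.
  by rewrite [leRHS]mulrC -ler_pdivrMr//; exact: MT.
have h4 : 12 * (F * eps') * s `^ a <= eps * s `^ a.
  by apply: ler_wpM2r => //; rewrite epsE; lra.
move: h1 h2 h3 h4; clear; lra.
Qed.

End global_oscillation.

(** * The Hoelder quotient with the Euclidean norm *)

Section euclidean_quotient.
Context {R : realType} {n : nat}.
Implicit Types (x y : 'rV[R]_n) (a : R) (u : 'rV[R]_n -> R).

Lemma le_norm_enorm x : `|x| <= enorm x.
Proof.
apply: norm_le_coord; first exact: sqrtr_ge0.
move=> i; rewrite -sqrtr_sqr; apply: ler_wsqrtr.
by rewrite (bigD1 i)//= lerDl; apply: sumr_ge0 => j _; exact: sqr_ge0.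
Qed.

Lemma enorm_continuous : continuous (@enorm R n).
Proof.
move=> x.
have cs : continuous (fun y : 'rV[R]_n => \sum_i y ord0 i ^+ 2).
  apply: continuous_big; first exact: add_continuous.
  move=> i _ y; apply: (continuous_comp (f := fun z : 'rV[R]_n => z ord0 i)
    (g := fun t : R => t ^+ 2)).
    exact: coord_continuous.
  exact: exprn_continuous.
exact: (continuous_comp (cs x) (@sqrt_continuous R _)).
Qed.

Lemma powR_continuous_at a (t : R) : 0 < t -> {for t, continuous (@powR R ^~ a)}.
Proof.
move=> t0; apply/differentiable_continuous/derivable1_diffP.
by have [] := is_derive1_powR a t0.
Qed.

Lemma holder_quotient_continuous a u (z : 'rV[R]_n * 'rV[R]_n) :
  continuous u -> z.1 != z.2 ->
  {for z, continuous (fun w => holder_quotient a u w.1 w.2)}.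
Proof.
move=> cu z12.
have e0 : 0 < enorm (z.1 - z.2).
  by apply: lt_le_trans (le_norm_enorm _); rewrite normr_gt0 subr_eq0.
have c1 : {for z, continuous (fun w : 'rV[R]_n * 'rV[R]_n => w.1)} by exact: cvg_fst.
have c2 : {for z, continuous (fun w : 'rV[R]_n * 'rV[R]_n => w.2)} by exact: cvg_snd.
have cu1 := continuous_comp c1 (cu z.1).
have cu2 := continuous_comp c2 (cu z.2).
have cN := continuous_comp (continuousB cu1 cu2) (@norm_continuous _ _ _).
have cE := continuous_comp (continuousB c1 c2) (@enorm_continuous _).
have cP := continuous_comp cE (@powR_continuous_at a _ e0).
apply: (continuousM cN); apply: (continuousV _ cP).
by rewrite gt_eqF// powR_gt0.
Qed.

(** The sup norm is at most the Euclidean one and [a] is nonnegative, so the sup-norm estimate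
    passes over with the same constant. *)
Lemma holder_quotient_le a u x y (C : R) : 0 <= a -> x != y ->
  `|u x - u y| <= C * `|x - y| `^ a -> holder_quotient a u x y <= C.
Proof.
move=> a0 xy h.
have s0 : 0 < `|x - y| by rewrite normr_gt0 subr_eq0.
have C0 : 0 <= C by rewrite -(pmulr_lge0 _ (powR_gt0 a s0)) (le_trans _ h).
have se := le_norm_enorm (x - y).
rewrite /holder_quotient ler_pdivrMr ?powR_gt0 ?(lt_le_trans s0)//.
apply: (le_trans h); apply: ler_wpM2l => //.
by apply: ge0_ler_powR se; rewrite // nnegrE ?sqrtr_ge0.
Qed.

End euclidean_quotient.

Theorem theorem6p1 (R : realType) (n : nat) (p : R) (u : 'rV[R]_n -> R) :
  (1 <= n)%N ->
  n%:R < p ->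
  D1p p u ->
  (* u is identified with its (unique) continuous representative *)
  continuous u ->
  (~ exists c : R, forall x, u x = c) ->
  exists x0 y0 : 'rV[R]_n, x0 != y0 /\
    holder_seminorm (1 - n%:R / p) u =
    (holder_quotient (1 - n%:R / p) u x0 y0)%:E.
Proof.
move=> n1 np Du cu nconst; set a := 1 - n%:R / p.
have p0 : 0 < p by rewrite (le_lt_trans _ np).
have a0 : 0 <= a by rewrite subr_ge0 ler_pdivrMr// mul1r ltW.
pose q (w : 'rV[R]_n * 'rV[R]_n) := holder_quotient a u w.1 w.2.
have [x1 [y1 uxy1]] : exists x y, u x != u y.
  apply: contrapT => h; apply: nconst; exists (u 0) => x.
  by apply/eqP/negP => /negP ne; apply: h; exists x, 0.
have xy1 : x1 != y1 by apply: contraNneq uxy1 => ->.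
have q1 : 0 < q (x1, y1).
  rewrite divr_gt0 ?normr_gt0 ?subr_eq0// powR_gt0//.
  by apply: lt_le_trans (le_norm_enorm _); rewrite normr_gt0 subr_eq0.
(* Half of the positive quotient at [(x1, y1)] is the threshold. This pair exceeds it, so it lies in
   [K], and the maximum over [K] beats every pair outside. *)
have [d [L [d0 HdL]]] := global_oscillation n1 np Du cu (divr_gt0 q1 (ltr0n R 2)).
pose B : set 'rV[R]_n := cube (const_mx (- L)) (2 * L).
(* The closed condition with [d > 0] keeps [K] compact and off the diagonal, where the quotient is
   continuous. *)
pose K := (B `*` B) `&` [set w | d <= `|w.1 - w.2|].
have KP x y : x != y -> K (x, y) \/ q (x, y) <= q (x1, y1) / 2.
  move=> xy; have [[dxy xL yL]|h] := HdL x y xy; last first.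
    by right; exact: holder_quotient_le.
  have BL z : `|z| <= L -> B z.
    move=> zL i; have := le_trans (coord_le_norm z i) zL.
    by rewrite mxE ler_norml => /andP[h1 h2]; apply/andP; split; lra.
  by left; split=> //; split; exact: BL.
have K1 : K (x1, y1).
  by have [//|] := KP _ _ xy1; rewrite leNgt ltr_pdivrMr// ltr_pMr// ltr1n.
have cK : compact K.
  apply: compact_closedI.
    by apply: compact_setX; exact: cube_compact.
  apply: (@preimage_closed _ _ (fun w : 'rV[R]_n * 'rV[R]_n => `|w.1 - w.2|)
    [set t | d <= t]); last exact: closed_ge.
  move=> w _.
  have c1 : {for w, continuous (fun w : 'rV[R]_n * 'rV[R]_n => w.1)} by exact: cvg_fst.
  have c2 : {for w, continuous (fun w : 'rV[R]_n * 'rV[R]_n => w.2)} by exact: cvg_snd.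
  exact: (continuous_comp (continuousB c1 c2) (@norm_continuous _ _ _)).
have Kne w : K w -> w.1 != w.2.
  by move=> [_ /= dw]; rewrite -subr_eq0 -normr_gt0 (lt_le_trans d0).
have [||[x0 y0]] := @compact_EVT_max _ _ q K _ cK.
- by exists (x1, y1).
- apply: continuous_in_subspaceT => w /[!inE] /Kne.
  exact: holder_quotient_continuous.
rewrite inE => K0 qmax; exists x0, y0; split; first exact: Kne K0.
apply/eqP; rewrite eq_le; apply/andP; split.
  apply: ge_ereal_sup => _ [[x y] /= xy <-]; rewrite lee_fin.
  have q10 := qmax _ (mem_set K1).
  have [Kxy|qxy] := KP x y xy; first exact: qmax (x, y) (mem_set Kxy).
  apply: le_trans (le_trans qxy _) q10.
  by rewrite ler_pdivrMr// ler_peMr ?(ltW q1)// ler1n.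
by apply: ereal_sup_ubound; exists (x0, y0) => //; exact: Kne K0.
Qed.
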